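(* Let $\mathcal X\subseteq[0,1]$ be a Borel set with $0,1\in\mathcal X$, fix $T\ge 1$ and $\mu\in(0,1)$, and let $I_\mu=[(\mu-1)^{-1},\mu^{-1}]$. Let $$\mathcal H^T_\mu=\big\{P\in\mathcal P_{\mathcal X^T}:\ \mathbb E_P[X_t\mid X^{t-1}]=\mu\ \ P\text{-a.s.},\ \forall t\in\{1,\dots,T\}\big\},$$ with the convention $\mathbb E_P[X_1\mid X^0]=\mathbb E_P[X_1]$. Let $\Lambda^T_\mu$ be the set of $T$-tuples $\lambda^T=(\lambda_1,\dots,\lambda_T)$ where each $\lambda_t:\mathcal X^{t-1}\to I_\mu$ is Borel (with $\lambda_1$ simply an element of $I_\mu$), and for $\lambda^T\in\Lambda^T_\mu$ let $E_{\lambda^T}(x^T)=\prod_{t=1}^T\big(1+\lambda_t(x^{t-1})(x_t-\mu)\big)$. Then the class $\mathcal E^{\mathrm{cb},T}_\mu=\{E_{\lambda^T}:\lambda^T\in\Lambda^T_\mu\}$ is the optimal e-class for $\mathcal H^T_\mu$.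
   Context: $\mathcal P_{\mathcal X^T}$ is the set of Borel probability measures on $\mathcal X^T$; $x^t=(x_1,\dots,x_t)$ and $X^t=(X_1,\dots,X_t)$ denotes the first $t$ coordinates. For a hypothesis $\mathcal H$ (non-empty set of Borel probability measures on a Borel set $\mathcal Z\subseteq\mathbb R^d$), an e-variable is a Borel $E:\mathcal Z\to[0,+\infty)$ with $\mathbb E_P[E]\le1$ for all $P\in\mathcal H$; $\mathcal E_{\mathcal H}$ is the set of all of them and an e-class is any subset of it. $f\succeq f'$ means $f\ge f'$ pointwise. An e-class $\mathcal E$ is majorising if for every $E'\in\mathcal E_{\mathcal H}$ there is $E\in\mathcal E$ with $E\succeq E'$. A majorising e-class is optimal if it is contained in every other majorising e-class. *)

(* Defs.v *)
From HB Require Import structures.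
From mathcomp Require Import all_boot all_order all_algebra.
From mathcomp Require Import all_classical all_reals all_analysis.
Unset Printing Implicit Defensive.
Import Order.TTheory GRing.Theory Num.Theory.
Local Open Scope classical_set_scope.
Local Open Scope ring_scope.

Section Defs.
Variable R : realType.

(* The ambient space R^n is n.-tuple R, with the library's product
   sigma-algebra (generated by the coordinate projections), which is the
   Borel sigma-algebra of R^n. *)

Definition cube (X : set R) (n : nat) : set (n.-tuple R) :=
  [set y | forall i : 'I_n, X (tnth y i)].

(* x^t : the first t coordinates of x (t < T, 0-based coordinate t is X_{t+1}) *)
Definition prefix (T : nat) (t : 'I_T) (x : T.-tuple R) : (t : nat).-tuple R :=
  [tuple tnth x (widen_ord (ltnW (ltn_ord t)) i) | i < t].

(* the hypothesis H^T_mu: Borel probability measures on X^T (represented as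
   probability measures on R^T giving full mass to X^T) such that
   E_P[X_{t+1} | X^t] = mu P-a.s. for all t, written via the defining
   property of conditional expectation: for every Borel B of R^t,
   E_P[(X_{t+1} - mu) 1{X^t in B}] = 0. *)
Definition Hmu (X : set R) (T : nat) (mu : R)
    (P : probability (T.-tuple R) R) : Prop :=
  P (cube X T) = 1%E /\
  forall (t : 'I_T) (B : set ((t : nat).-tuple R)), measurable B ->
    (\int[P]_(x in cube X T `&` prefix T t @^-1` B)
        ((tnth x t)%:E - mu%:E) = 0)%E.

(* e-variables for H^T_mu: Borel functions on X^T, nonnegative, with
   expectation at most 1 under every P in H^T_mu.  Functions are
   represented on R^T; only their restriction to X^T matters. *)
Definition evar (X : set R) (T : nat) (mu : R) (E : T.-tuple R -> R) : Prop :=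
  measurable_fun (cube X T) E /\
  (forall x, cube X T x -> 0 <= E x) /\
  forall P : probability (T.-tuple R) R, Hmu X T mu P ->
    (\int[P]_(x in cube X T) (E x)%:E <= 1)%E.

Definition eclass (X : set R) (T : nat) (mu : R)
    (C : set (T.-tuple R -> R)) : Prop :=
  C `<=` evar X T mu.

Definition majorising (X : set R) (T : nat) (mu : R)
    (C : set (T.-tuple R -> R)) : Prop :=
  eclass X T mu C /\
  forall E', evar X T mu E' ->
    exists2 E, C E & forall x, cube X T x -> E' x <= E x.

(* containment of classes of functions on X^T (functions identified with
   their restrictions to X^T) *)
Definition subclass (X : set R) (T : nat) (C C' : set (T.-tuple R -> R)) :=
  forall E, C E -> exists2 E', C' E' & forall x, cube X T x -> E x = E' x.

Definition optimal (X : set R) (T : nat) (mu : R)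
    (C : set (T.-tuple R -> R)) : Prop :=
  majorising X T mu C /\
  forall C', majorising X T mu C' -> subclass X T C C'.

Definition Imu (mu : R) : set R := `[(mu - 1)^-1, mu^-1].

(* Lambda^T_mu : lambda t : R^t -> R (for t = 0 a constant on the
   one-point space R^0), Borel on X^t, with values in I_mu on X^t *)
Definition Lambda (X : set R) (T : nat) (mu : R)
    (lam : forall t : 'I_T, (t : nat).-tuple R -> R) : Prop :=
  forall t : 'I_T,
    measurable_fun (cube X t) (lam t) /\
    forall y, cube X t y -> Imu mu (lam t y).

Definition Elam (T : nat) (mu : R)
    (lam : forall t : 'I_T, (t : nat).-tuple R -> R) (x : T.-tuple R) : R :=
  \prod_(t < T) (1 + lam t (prefix T t x) * (tnth x t - mu)).

Definition Ecb (X : set R) (T : nat) (mu : R) : set (T.-tuple R -> R) :=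
  [set E | exists2 lam, Lambda X T mu lam & E = Elam T mu lam].

End Defs.
Arguments cube {R}.
Arguments prefix {R}.
Arguments Hmu {R}.
Arguments evar {R}.
Arguments eclass {R}.
Arguments majorising {R}.
Arguments subclass {R}.
Arguments optimal {R}.
Arguments Imu {R}.
Arguments Lambda {R}.
Arguments Elam {R}.
Arguments Ecb {R}.

(* Main.v *)
Require Import Defs.
From HB Require Import structures.
From mathcomp Require Import all_boot all_order all_algebra.
From mathcomp Require Import all_classical all_reals all_analysis.
From mathcomp Require Import measurable_realfun ring lra.
Import Order.TTheory GRing.Theory Num.Theory.
Local Open Scope classical_set_scope.
Local Open Scope ring_scope.
Set Implicit Arguments.
Unset Strict Implicit.

(* Every [E_lambda] has mean 1 under the hypothesis, because
   [1 + l (x - mu) = (1 - l mu) (1 - x) + (1 + l (1 - mu)) x] has nonnegative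
   coefficients when [l] is in [I_mu].

   Conversely, let [E] be an e-variable.  Only martingale distributions with
   finite support are needed: averaging over the two-point distributions with
   mean [mu] for the last round turns the constraint "wealth at least [E]" into
   a constraint on the wealth one round earlier, and iterating down to round 0
   yields wealth at most 1.  Going forward, once the wealth [u x] after the
   round [t] is fixed, the admissible bets form an interval: the bets that are
   too small because of an outcome above [mu], and those too large because of
   an outcome below [mu], form disjoint sets.  The bet must moreover be a Borel
   function of the past, whereas the constraints are only analytic, since they
   are obtained by projection.  For each rational [q], Lusin's theorem separates
   the pasts for which [q] is too small from those for which it is too large by
   a Borel set, and the bet is the supremum of the [q] selected in this way.

   Finally [E_lambda <= E_lambda'] forces equality: an affine function of the
   outcome is determined by its values at 0 and 1.  Hence every majorising class
   contains each [E_lambda]. *)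

(** * Analytic sets *)

(** Basic neighbourhoods of the Baire space. Finite lists of positions, unlike initial segments, are
    stable by reindexing of the coordinates. *)
Definition agree (s : seq nat) (a b : nat -> nat) := {in s, a =1 b}.

Lemma agree_map (f : nat -> nat) s a b :
  agree (map f s) a b -> agree s (a \o f) (b \o f).
Proof. by move=> h k ks; apply: h; apply: map_f. Qed.

Lemma agree_cat s1 s2 a b :
  agree (s1 ++ s2) a b <-> agree s1 a b /\ agree s2 a b.
Proof.
split=> [h|[h1 h2] k]; last by rewrite mem_cat => /orP[/h1|/h2].
by split=> k ks; apply: h; rewrite mem_cat ks ?orbT.
Qed.

(* [Q] encodes a partial map from a closed subset of the Baire space to [Y] that
   is continuous once every [G k] is declared clopen. *)
Definition resolves (Y K : Type) (G : K -> set Y) (Q : (nat -> nat) -> set Y) :=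
  forall a, (forall s, exists b, agree s a b /\ Q b !=set0) ->
  exists2 y, Q a y & forall k, exists s, forall b z,
    agree s a b -> Q b z -> (G k z <-> G k y).

(* Asking for a parametrisation for every [G], instead of one that is continuous
   for a fixed topology, makes the notion stable by measurable images without
   any change of topology. *)
Definition analytic d (Y : measurableType d) (A : set Y) :=
  forall (K : countType) (G : K -> set Y), (forall k, measurable (G k)) ->
  exists2 Q, resolves G Q & A = \bigcup_a Q a.

Definition separating (Y K : Type) (G : K -> set Y) :=
  forall y z, (forall k, G k y <-> G k z) -> y = z.

(** Countable separation plays the role of the Hausdorff property: it identifies limits obtained
    from different codes. *)
Definition separated d (Y : measurableType d) :=
  exists (K : countType) (G : K -> set Y),
    (forall k, measurable (G k)) /\ separating G.

Section analytic.
Context d d' (Y : measurableType d) (Y' : measurableType d').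

(** A parametrisation of [A] adapted to the preimages of the sets [G k] becomes one of the image by
    composition with [f]. *)
Lemma analytic_image (f : Y -> Y') (A : set Y) :
  measurable_fun setT f -> analytic A -> analytic (f @` A).
Proof.
move=> mf aA K G mG.
have [|Q rQ AQ] := aA K (fun k => f @^-1` G k).
  by move=> k; rewrite -[X in measurable X]setTI; apply: mf.
exists (fun a => f @` Q a); last first.
  by rewrite AQ image_bigcup.
move=> a ha.
have [|y Qy cy] := rQ a.
  by move=> s; have [b [ab [_ [z Qz _]]]] := ha s; exists b; split => //; exists z.
exists (f y); first by exists y.
move=> k; have [s hs] := cy k; exists s => b _ ab [z Qz <-].
exact: (hs b z ab Qz).
Qed.

(** A code interleaves a code of a point of [A] (even entries) with a code of its image in [B] (odd
    entries). *)
Lemma analytic_setI_preimage (f : Y -> Y') (A : set Y) (B : set Y') :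
  measurable_fun setT f -> separated Y' -> analytic A -> analytic B ->
  analytic (A `&` f @^-1` B).
Proof.
move=> mf [K' [G' [mG' sepG']]] aA aB K G mG.
pose GG (k : K + K') := match k with inl k => G k | inr k => f @^-1` G' k end.
have [|Q1 r1 A1] := aA (K + K')%type GG.
  by case=> k //=; rewrite -[X in measurable X]setTI; apply: mf.
have [//|Q2 r2 B2] := aB K' G'.
pose ev n := n.*2; pose od n := n.*2.+1.
exists (fun a => Q1 (a \o ev) `&` f @^-1` Q2 (a \o od)); last first.
  rewrite A1 B2; apply/seteqP; split=> [y [[a _ Q1y] [b _ Q2y]]|y [a _ [Qy Q'y]]].
    exists (fun n => if odd n then b n./2 else a n./2) => //; split => /=.
      by rewrite (_ : _ \o _ = a) //; apply/funext => n /=;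
         rewrite odd_double doubleK.
    by rewrite (_ : _ \o _ = b) //; apply/funext => n /=;
         rewrite odd_double/= uphalf_double.
  by split; [exists (a \o ev)|exists (a \o od)].
move=> a ha.
have [|y Qy cy] := r1 (a \o ev).
  move=> s; have [b [ab [z [Qz _]]]] := ha (map ev s).
  by exists (b \o ev); split; [exact: agree_map|exists z].
have [|y' Qy' cy'] := r2 (a \o od).
  move=> s; have [b [ab [z [_ Qz]]]] := ha (map od s).
  by exists (b \o od); split; [exact: agree_map|exists (f z)].
(* For each [k], some [z] coded close to [a] has [f z] on the same side of [G' k] as [f y] and as
   [y']. *)
have yy' : f y = y'.
  apply: sepG' => k; have [s /= hs] := cy (inr k); have [s' hs'] := cy' k.
  have [b [/agree_cat[ab ab'] [z [Q1z Q2z]]]] := ha (map ev s ++ map od s').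
  by rewrite -(hs' _ _ (agree_map ab') Q2z)
             -(hs _ _ (agree_map ab) Q1z).
exists y; first by split => //=; rewrite yy'.
move=> k; have [s hs] := cy (inl k); exists (map ev s) => b z ab [Qz _].
exact: hs (agree_map ab) Qz.
Qed.

(* Adding [A] to the clopen sets makes the restriction to [A] closed. *)
Lemma measurable_analytic (A : set Y) :
  analytic [set: Y] -> measurable A -> analytic A.
Proof.
move=> aT mA K G mG.
pose GG (k : option K) := if k is Some k then G k else A.
have [|Q rQ TQ] := aT (option K) GG; first by case.
exists (fun a => Q a `&` A); last first.
  apply/seteqP; split=> [y Ay|y [a _ []]//].
  have : [set: Y] y by []. rewrite TQ => -[a _ Qy]; exists a => //.
move=> a ha.
have [|y Qy cy] := rQ a.
  by move=> s; have [b [ab [z [Qz _]]]] := ha s; exists b; split => //; exists z.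
exists y.
  split=> //; have [s hs] := cy None; have [b [ab [z [Qz Az]]]] := ha s.
  exact/(hs b z ab Qz).
by move=> k; have [s hs] := cy (Some k); exists s => b z ab [Qz _]; exact: (hs b z ab Qz).
Qed.

End analytic.

(** * Lusin's separation theorem *)

Section lusin.
Context d (Y : measurableType d).

Let sepd (A B : set Y) := exists2 D, measurable D & A `<=` D /\ B `<=` ~` D.

Let sepd_bigcup (A B : nat -> set Y) :
  (forall m n, sepd (A m) (B n)) -> sepd (\bigcup_m A m) (\bigcup_n B n).
Proof.
move=> h.
have {}h mn : exists D, measurable D /\ A mn.1 `<=` D /\ B mn.2 `<=` ~` D.
  by have [D mD AB] := h mn.1 mn.2; exists D.
have [D hD] := choice h.
exists (\bigcup_m \bigcap_n D (m, n)).
  by apply: bigcup_measurable => m _; apply: bigcap_measurable => // n _;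
     have [] := hD (m, n).
split=> y [m _ Ay].
  by exists m => // n _; have [_ [+ _]] := hD (m, n); apply.
by move=> [n _ /(_ m I)]; have [_ [_]] := hD (n, m); apply.
Qed.

(** If no measurable set separates [A] from [B], inseparability passes to smaller and smaller
    cylinders of codes. The two limit codes give points [y] of [A] and [z] of [B], distinct by
    disjointness; some [G k] tells them apart, and near the limits it separates the cylinders. *)
Lemma lusin_separation (A B : set Y) : separated Y ->
  analytic A -> analytic B -> A `&` B = set0 ->
  exists2 D, measurable D & A `<=` D /\ B `<=` ~` D.
Proof.
move=> [K [G [mG sepG]]] aA aB AB0.
have [P rP AP] := aA K G mG; have [Q rQ BQ] := aB K G mG.
pose cyl (S : (nat -> nat) -> set Y) (a : nat -> nat) n :=
  \bigcup_(b in agree (iota 0 n) a) S b.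
pose ext (a : nat -> nat) n m k := if k == n then m else a k.
have ext_agree a n m : agree (iota 0 n) a (ext a n m).
  by move=> k; rewrite mem_iota /ext => /andP[_]; case: eqP => // ->; rewrite ltnn.
have cylS S a n : cyl S a n = \bigcup_m cyl S (ext a n m) n.+1.
  apply/seteqP; split=> [y [b ab Sy]|y [m _ [b ab Sy]]].
    exists (b n) => //; exists b => // k; rewrite mem_iota /ext /= add0n ltnS.
    by case: eqP => [->//|/eqP kn kn']; apply: ab; rewrite mem_iota ltn_neqAle kn.
  exists b => // k ks; rewrite (ext_agree a n m)//; apply: ab.
  by move: ks; rewrite !mem_iota !add0n => /andP[_ /ltnW].
apply: contrapT => nAB.
(* Inseparability is a premise inside the existential, so that the choice of refinements is a total
   function. *)
have step (n : nat) (ab : (nat -> nat) * (nat -> nat)) :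
  exists ab' : (nat -> nat) * (nat -> nat),
    ~ sepd (cyl P ab.1 n) (cyl Q ab.2 n) ->
    [/\ agree (iota 0 n) ab.1 ab'.1, agree (iota 0 n) ab.2 ab'.2 &
        ~ sepd (cyl P ab'.1 n.+1) (cyl Q ab'.2 n.+1)].
  have [h|h] := pselect (sepd (cyl P ab.1 n) (cyl Q ab.2 n)).
    by exists ab.
  suff [m [m' hm]] : exists m m', ~ sepd (cyl P (ext ab.1 n m) n.+1)
      (cyl Q (ext ab.2 n m') n.+1).
    by exists (ext ab.1 n m, ext ab.2 n m') => _; split => //; exact: ext_agree.
  apply: contrapT => hn; apply: h; rewrite !cylS; apply: sepd_bigcup => m m'.
  by apply: contrapT => hm; apply: hn; exists m, m'.
have {step} [F hF] := choice (fun nab => step nab.1 nab.2).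
pose st := fix st n := if n is m.+1 then F (m, st m)
                       else ((fun=> 0%N), (fun=> 0%N)).
have st_nsep n : ~ sepd (cyl P (st n).1 n) (cyl Q (st n).2 n).
  elim: n => [|n IH]; last by have [] := hF (n, st n) IH.
  move=> [D mD [AD BD]]; apply: nAB; exists D => //; split.
    by rewrite AP => y [a _ Py]; apply: AD; exists a.
  by rewrite BQ => y [a _ Py]; apply: BD; exists a.
have st_agree n m : agree (iota 0 n) (st n).1 (st (m + n)%N).1 /\
                  agree (iota 0 n) (st n).2 (st (m + n)%N).2.
  elim: m => [//|m [IH1 IH2]].
  have [h1 h2 _] := hF ((m + n)%N, st (m + n)%N) (st_nsep _).
  by split=> k ks; rewrite ?IH1 ?IH2// ?h1 ?h2//;
    move: ks; rewrite !mem_iota !add0n /= => /leq_trans; apply; apply: leq_addl.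
(* Entry [k] no longer changes after stage [k.+1], where it is read. *)
pose a k := (st k.+1).1 k; pose b k := (st k.+1).2 k.
have aE n : agree (iota 0 n) a (st n).1.
  move=> k; rewrite mem_iota /= add0n => kn.
  have [+ _] := st_agree k.+1 (n - k.+1)%N.
  by rewrite subnK// /a /b => ->//; rewrite mem_iota /= add0n.
have bE n : agree (iota 0 n) b (st n).2.
  move=> k; rewrite mem_iota /= add0n => kn.
  have [_ +] := st_agree k.+1 (n - k.+1)%N.
  by rewrite subnK// /a /b => ->//; rewrite mem_iota /= add0n.
have cyl_eq S c c' n : agree (iota 0 n) c c' -> cyl S c n = cyl S c' n.
  move=> cc'; apply/seteqP; split=> y [e ce Se]; exists e => // k ks.
    by rewrite -cc'// ce.
  by rewrite cc'// ce.
have nsep n : ~ sepd (cyl P a n) (cyl Q b n).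
  by rewrite (cyl_eq P _ _ _ (aE n)) (cyl_eq Q _ _ _ (bE n)).
have bnd (s : seq nat) : exists n, {subset s <= iota 0 n}.
  elim: s => [|k s [n sn]]; first by exists 0%N.
  exists (maxn n k.+1) => j; rewrite inE => /orP[/eqP->|/sn];
  by rewrite !mem_iota /= !add0n leq_max ?leqnn ?orbT// => ->.
(* The limit code meets the premise of [resolves]: an empty cylinder would be separated from any
   set. *)
have [|y Py cy] := rP a.
  move=> s; have [n sn] := bnd s.
  suff [z [c ac Pz]] : cyl P a n !=set0.
    by exists c; split; [move=> k /sn; apply: ac|exists z].
  apply/set0P/negP => /eqP c0; apply: (nsep n); rewrite c0.
  by exists set0 => //; split => // z _ [].
have [|z Qz cz] := rQ b.
  move=> s; have [n sn] := bnd s.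
  suff [z [c ac Pz]] : cyl Q b n !=set0.
    by exists c; split; [move=> k /sn; apply: ac|exists z].
  apply/set0P/negP => /eqP c0; apply: (nsep n); rewrite c0.
  by exists setT => //; split => // z.
have yz : y <> z.
  move=> yz; have : (A `&` B) y.
    by rewrite AP BQ; split; [exists a|exists b => //; rewrite yz].
  by rewrite AB0.
apply: yz; apply: sepG => k; apply: contrapT => Gk.
have [s hs] := cy k; have [s' hs'] := cz k.
have [n sn] := bnd (s ++ s').
have hy : cyl P a n `<=` [set w | G k w <-> G k y].
  move=> w [c ac Pw]; apply: (hs c) => // j js; apply: ac; apply: sn.
  by rewrite mem_cat js.
have hz : cyl Q b n `<=` [set w | G k w <-> G k z].
  move=> w [c ac Pw]; apply: (hs' c) => // j js; apply: ac; apply: sn.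
  by rewrite mem_cat js orbT.
apply: (nsep n); have [Gy|Gy] := pselect (G k y).
  exists (G k) => //; split=> w; first by move=> /hy [_]; apply.
  by move=> /hz /= -> Gz; apply: Gk.
exists (~` G k); first exact: measurableC.
split=> w; first by move=> /hy /= ->.
by move=> /hz /= Gw nGw; apply: Gk; split=> [/Gy|/Gw /nGw].
Qed.

End lusin.

(** * Countable refinements of a topology *)

Section clopenable.
Variables (Y : Type) (K : countType) (G : K -> set Y).
Hypothesis sepG : separating G.

(* The sets that can be made clopen by refining the topology. *)
Definition clopenable (A : set Y) :=
  exists2 Q, resolves (fun k => if k is Some k then G k else A) Q &
             [set: Y] = \bigcup_a Q a.

(** A single code packs one code per index by means of [pickle]. They all describe the same point
    because [G] separates points; the limit is read at the index [i0]. *)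
Lemma clopenable_merge (I : countType) (i0 : I) (A : I -> set Y) :
  (forall i, clopenable (A i)) ->
  exists2 Q, resolves (fun k : K + I => match k with inl k => G k | inr i => A i end) Q
           & [set: Y] = \bigcup_a Q a.
Proof.
move=> cA.
have {}cA i : exists Q, resolves (fun k => if k is Some k then G k else A i) Q /\
    [set: Y] = \bigcup_a Q a by have [Q rQ TQ] := cA i; exists Q.
have [Q hQ] := choice cA.
pose sub (i : I) (n : nat) := pickle (i, n).
have sub_inj (s : seq nat) i a b :
    agree (map (sub i) s) a b -> agree s (a \o sub i) (b \o sub i).
  exact: agree_map.
exists (fun a => \bigcap_i Q i (a \o sub i)); last first.
  apply/seteqP; split=> // y _.
  have {}hy i : exists a, Q i a y.
    by have : [set: Y] y by []; have [_ ->] := hQ i; move=> [a _ Qy]; exists a.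
  have [a ha] := choice hy.
  exists (fun n => if @unpickle (I * nat)%type n is Some (i, m) then a i m
                   else 0%N) => //.
  move=> i _; rewrite (_ : _ \o _ = a i)//; apply/funext => n /=.
  by rewrite pickleK.
move=> a ha.
have {}hy i : exists y, Q i (a \o sub i) y /\ forall k, exists s, forall b z,
    agree s (a \o sub i) b -> Q i b z ->
    ((if k is Some k then G k else A i) z <-> (if k is Some k then G k else A i) y).
  have [rQ _] := hQ i; have [|y Qy cy] := rQ (a \o sub i); last by exists y.
  move=> s; have [b [ab [z Qz]]] := ha (map (sub i) s).
  by exists (b \o sub i); split; [exact: sub_inj|exists z; apply: Qz].
have [y hy'] := choice hy.
have yi i : y i = y i0.
  apply: sepG => k.
  have [_ /(_ (Some k)) [s hs]] := hy' i; have [_ /(_ (Some k)) [t ht]] := hy' i0.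
  have [b [/agree_cat[ab1 ab2] [z Qz]]] := ha (map (sub i) s ++ map (sub i0) t).
  rewrite -(hs _ z (sub_inj _ _ _ _ ab1)); last exact: Qz.
  by rewrite -(ht _ z (sub_inj _ _ _ _ ab2)); last exact: Qz.
exists (y i0); first by move=> i _; rewrite -(yi i); have [] := hy' i.
case=> [k|i].
  have [_ /(_ (Some k)) [s hs]] := hy' i0.
  exists (map (sub i0) s) => b z ab Qz; apply: (hs (b \o sub i0)); last exact: Qz.
  exact: sub_inj.
have [_ /(_ None) [s hs]] := hy' i.
exists (map (sub i) s) => b z ab Qz; rewrite -(yi i).
by apply: (hs (b \o sub i)); [exact: sub_inj|exact: Qz].
Qed.

(** Complements keep the same parametrisation; for a union, an extra first entry of the code tells
    which member, if any, contains the point. The assumption on [set0] amounts to a parametrisation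
    adapted to [G] alone. *)
Lemma clopenable_sigma_algebra :
  clopenable set0 -> sigma_algebra setT clopenable.
Proof.
move=> c0; split=> // [A [Q rQ TQ]|A cA].
  exists Q => // a /rQ[y Qy cy]; exists y => // -[k|].
    exact: (cy (Some k)).
  have [s hs] := cy None; exists s => b z ab Qz.
  by have /= h := hs b z ab Qz; split=> -[_ nA]; split=> // /h.
have [Q rQ TQ] := clopenable_merge 0%N cA.
(* [a 0] names an index [i] with [y \in A i], or is [0] if there is none *)
exists (fun a => Q (a \o succn) `&`
   if a 0%N is i.+1 then A i else \bigcap_i ~` A i); last first.
  apply/seteqP; split=> // y _.
  have : [set: Y] y by []. rewrite TQ => -[a _ Qy].
  have [[i _ Ay]|nAy] := pselect ((\bigcup_i A i) y).
    by exists (fun n => if n is m.+1 then a m else i.+1).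
  exists (fun n => if n is m.+1 then a m else 0%N) => //; split => // i _ Ay.
  by apply: nAy; exists i.
move=> a ha.
have sS s b : agree (0%N :: map succn s) a b ->
    a 0%N = b 0%N /\ agree s (a \o succn) (b \o succn).
  move=> ab; split; first by apply: ab; rewrite mem_head.
  by apply: agree_map => k ks; apply: ab; rewrite inE ks orbT.
have [|y Qy cy] := rQ (a \o succn).
  move=> s; have [b [/sS[_ ab] [z [Qz _]]]] := ha (0%N :: map succn s).
  by exists (b \o succn); split => //; exists z.
exists y.
  split => //; case a0 : (a 0%N) => [|i].
    move=> i _; have [s hs] := cy (inr i).
    have [b [/sS[b0 ab] [z [Qz]]]] := ha (0%N :: map succn s).
    by rewrite -b0 a0 => /(_ i I); rewrite /= -(hs _ _ ab Qz).
  have [s hs] := cy (inr i).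
  have [b [/sS[b0 ab] [z [Qz]]]] := ha (0%N :: map succn s).
  by rewrite -b0 a0 => /(hs _ _ ab Qz).
case=> [k|].
  have [s hs] := cy (inl k); exists (0%N :: map succn s) => b z /sS[_ ab] [Qz _].
  exact: hs ab Qz.
case a0 : (a 0%N) => [|i].
  have nA : forall z, (\bigcap_i ~` A i) z -> ~ (\bigcup_i A i) z.
    by move=> z h [i _]; apply: h.
  exists [:: 0%N] => b z /(sS [::])[b0 _] [Qz]; rewrite -b0 a0 => /nA Az.
  split=> // -[i _]; have [s hs] := cy (inr i).
  have [c [/sS[ca ac] [w [Qw]]]] := ha (0%N :: map succn s).
  by rewrite -ca a0 => /(_ i I) /= + /(hs _ _ ac Qw).
have [s hs] := cy (inr i).
exists (0%N :: map succn s) => b z /sS[b0 ab] [Qz]; rewrite -b0 a0 => Az.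
by split=> _; exists i => //; apply/(hs _ _ ab Qz).
Qed.

End clopenable.

(** By the sigma-algebra property only generators have to be made clopen; any countable family of
    measurable sets is then treated at once by merging. *)
Lemma analyticT_clopenable d (Y : measurableType d) (K : countType)
    (G : K -> set Y) (C : set (set Y)) :
  separating G -> clopenable G set0 -> measurable `<=` <<s C >> ->
  C `<=` clopenable G -> analytic [set: Y].
Proof.
move=> sepG c0 mC CG I A mA.
have cA i : clopenable G (A i).
  apply: (@smallest_sub _ (sigma_algebra setT) C (clopenable G)) => //.
    exact: clopenable_sigma_algebra.
  exact: mC (mA i).
(* The index [None] is added because merging asks for an index even when [I] is empty. *)
have [|Q rQ TQ] := clopenable_merge sepG None
    (A := fun i : option I => if i is Some i then A i else set0).
  by case.
exists Q => // a /rQ[y Qy cy]; exists y => // i.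
exact: (cy (inr (Some i))).
Qed.

(** * Products of analytic spaces *)

Section product.
Context d d' (Y : measurableType d) (Z : measurableType d').

Lemma separated_prod : separated Y -> separated Z -> separated (Y * Z)%type.
Proof.
move=> [K [G [mG sG]]] [K' [G' [mG' sG']]].
exists (K + K')%type, (fun k => match k with
  | inl k => fst @^-1` G k | inr k => snd @^-1` G' k end); split.
  case=> k; rewrite -[X in measurable X]setTI.
    exact: measurable_fst.
  exact: measurable_snd.
move=> [y z] [y' z'] h; congr pair.
  by apply: sG => k; exact: (h (inl k)).
by apply: sG' => k; exact: (h (inr k)).
Qed.

(** Rectangles generate the product sigma-algebra, and interleaved codes of the two coordinates make
    any given rectangle clopen. *)
Lemma analyticT_prod : separated Y -> separated Z ->
  analytic [set: Y] -> analytic [set: Z] -> analytic [set: Y * Z].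
Proof.
move=> [K [G [mG sG]]] [K' [G' [mG' sG']]] aY aZ.
pose GG (k : K + K') : set (Y * Z) := match k with
  | inl k => fst @^-1` G k | inr k => snd @^-1` G' k end.
have rect A B : measurable A -> measurable B -> clopenable GG (A `*` B).
  move=> mA mB.
  have [|Q rQ TQ] := aY (option K) (fun k => if k is Some k then G k else A).
    by case.
  have [|P rP TP] := aZ (option K') (fun k => if k is Some k then G' k else B).
    by case.
  pose ev n := n.*2; pose od n := n.*2.+1.
  exists (fun a => Q (a \o ev) `*` P (a \o od)).
    move=> a ha.
    have [|y Qy cy] := rQ (a \o ev).
      move=> s; have [b [ab [z [Qz _]]]] := ha (map ev s).
      by exists (b \o ev); split; [exact: agree_map|exists z.1].
    have [|z Pz cz] := rP (a \o od).
      move=> s; have [b [ab [z [_ Qz]]]] := ha (map od s).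
      by exists (b \o od); split; [exact: agree_map|exists z.2].
    exists (y, z) => // -[[k|k]|].
    - have [s hs] := cy (Some k); exists (map ev s) => b w ab [Qw _].
      exact: (hs (b \o ev) w.1 (agree_map ab)).
    - have [s hs] := cz (Some k); exists (map od s) => b w ab [_ Pw].
      exact: (hs (b \o od) w.2 (agree_map ab)).
    have [s hs] := cy None; have [t ht] := cz None.
    exists (map ev s ++ map od t) => b w /agree_cat[ab ab'] [Qw Pw].
    have := hs (b \o ev) w.1 (agree_map ab) Qw.
    have := ht (b \o od) w.2 (agree_map ab') Pw.
    by rewrite /= => h h'; split=> -[/h' ? /h ?].
  apply/seteqP; split=> // -[y z] _.
  have : [set: Y] y by []. rewrite TQ => -[a _ Qy].
  have : [set: Z] z by []. rewrite TP => -[b _ Pz].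
  exists (fun n => if odd n then b n./2 else a n./2) => //; split => /=.
    rewrite (_ : _ \o _ = a) //; apply/funext => n /=.
    by rewrite odd_double doubleK.
  rewrite (_ : _ \o _ = b) //; apply/funext => n /=.
  by rewrite odd_double/= uphalf_double.
apply: (@analyticT_clopenable _ _ _ GG
    [set A `*` B | A in measurable & B in measurable]).
- move=> [y z] [y' z'] h; congr pair.
    by apply: sG => k; exact: (h (inl k)).
  by apply: sG' => k; exact: (h (inr k)).
- by have := rect set0 set0 measurable0 measurable0; rewrite set0X.
- by rewrite measurable_prod_measurableType.
- by move=> _ [A mA [B mB <-]]; apply: rect.
Qed.

End product.

(** * The real line *)

Section real.
Variable R : realType.

Let ray (q : rat) : set R := [set r | r < ratr q].

Let ray_measurable q : measurable (ray q).
Proof.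
have -> : ray q = `]-oo, ratr q[%classic by apply/seteqP; split=> r; rewrite /= in_itv.
exact: measurable_itv.
Qed.

Let ray_separating : separating ray.
Proof.
move=> y z h; apply/eqP; apply: contrapT => /negP.
rewrite neq_lt => /orP[yz|yz]; have [q] := rat_in_itvoo yz;
  rewrite in_itv /= => /andP[yq qz].
  by have [/(_ yq)] := h q; rewrite /ray /= ltNge (ltW qz).
by have [_ /(_ yq)] := h q; rewrite /ray /= ltNge (ltW qz).
Qed.

Lemma separated_real : separated R.
Proof. by exists rat, ray. Qed.

Section code.
Variables (num : rat -> nat) (unnum : nat -> option rat).
Hypothesis numK : pcancel num unnum.

(* [a 0] bounds [`|r|], and [a (num q).+1] decides [r < q], with a rational
   strictly below [q] and above [r] as a witness when the answer is positive. *)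
Let cut (q : rat) (c : nat) : set R := if c is m.+1
  then [set r : R | exists q' : rat, [/\ m = num q', q' < q & r <= ratr q']]
  else [set r : R | ratr q <= r].

Let code (a : nat -> nat) : set R :=
  [set r : R | - (a 0%N)%:R <= r <= (a 0%N)%:R] `&`
  [set r | forall q : rat, cut q (a (num q).+1) r].

Let code_full : [set: R] = \bigcup_a code a.
Proof.
apply/seteqP; split=> // r _.
have cut_ex q : exists c, cut q c r.
  have [qr|rq] := lerP (ratr q) r; first by exists 0%N.
  have [q'] := rat_in_itvoo rq; rewrite in_itv /= => /andP[rq' q'q].
  exists (num q').+1, q'; split=> //; last exact: ltW.
  by move: q'q; rewrite ltr_rat.
have [c hc] := choice cut_ex.
exists (fun n => if n is m.+1 then if unnum m is Some q then c q else 0%N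
                 else (Num.truncn `|r|).+1) => //; split => /=.
  by rewrite -ler_norml; rewrite ltW// truncnS_gt.
by move=> q; rewrite numK.
Qed.

(** The limit is the supremum of the rationals that the code places below the number. A code
    constrains the number by weak inequalities only, and these pass to the supremum. *)
Let code_resolves : resolves ray code.
Proof.
move=> a ha; pose N := a 0%N.
pose L : set R := [set x | exists2 q, a (num q).+1 = 0%N & x = ratr q].
have near q p : exists r, [/\ - N%:R <= r <= N%:R, cut q (a (num q).+1) r
                            & cut p (a (num p).+1) r].
  have [b [ab [r [br hr]]]] := ha [:: 0%N; (num q).+1; (num p).+1].
  exists r; rewrite /N !ab ?inE ?eqxx ?orbT//; split => //; exact: hr.
have NL : L (- N%:R).
  exists (- N%:R); last by rewrite rmorphN /= ratr_nat.
  have [r [/andP[Nr _] + _]] := near (- N%:R) 0.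
  case: (a _) => //= n [q [_ qN rq]].
  have : ratr q < - N%:R :> R by rewrite -(ratr_nat R N) -rmorphN ltr_rat.
  by rewrite ltNge (le_trans Nr rq).
have Lsup : has_sup L.
  split; first by exists (- N%:R).
  exists N%:R => _ [q q0 ->]; have [r [/andP[_ rN] + _]] := near q 0.
  by rewrite q0 /= => /le_trans; apply.
have hcut q : cut q (a (num q).+1) (sup L).
  case aq : (a (num q).+1) => [|m] /=.
    by apply: (sup_upper_bound Lsup); exists q.
  have [r [_ + _]] := near q 0; rewrite aq => -[q' [mq' q'q rq']].
  exists q'; split=> //; apply: ge_sup; first by case: Lsup.
  move=> _ [p p0 ->]; have [r' [_]] := near q p.
  rewrite aq p0 /= => -[q2 [mq2 _ r'q2]] /le_trans; apply.
  suff -> : q' = q2 by [].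
  by apply: (pcan_inj numK); rewrite -mq'.
exists (sup L).
  split=> //=; apply/andP; split; first exact: (sup_upper_bound Lsup).
  apply: ge_sup; first by case: Lsup.
  move=> _ [q q0 ->]; have [r [/andP[_ rN] + _]] := near q 0.
  by rewrite q0 /= => /le_trans; apply.
have cutE q c r : cut q c r -> (r < ratr q) = (c != 0)%N.
  case: c => [|m] /=; first by rewrite ltNge => ->.
  move=> [q' [_ q'q rq']]; apply: (le_lt_trans rq'); by rewrite ltr_rat.
move=> q; exists [:: (num q).+1] => b r ab [_ /(_ q) hr].
rewrite /ray /= (cutE _ _ _ hr) (cutE _ _ _ (hcut q)) ab//.
by rewrite inE.
Qed.

Lemma analyticT_real_numbering : analytic [set: R].
Proof.
have c0 : clopenable ray set0.
  exists code => // a /code_resolves[y Qy cy]; exists y => // -[k|]; first exact: cy.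
  by exists [::].
have cray q : clopenable ray (ray q).
  exists code => // a /code_resolves[y Qy cy]; exists y => //.
  by case=> [k|]; apply: cy.
apply: (@analyticT_clopenable _ R _ ray (@RGenInftyO.G R)) => //.
  by move=> B; rewrite /measurable /= /measurableR RGenInftyO.measurableE.
move=> _ [x ->].
pose A n := if unnum n is Some q then if ratr q < x then ray q else set0 else set0.
have -> : `]-oo, x[%classic = \bigcup_n A n.
  apply/seteqP; split=> r; rewrite /= in_itv /=.
    move=> /rat_in_itvoo[q]; rewrite in_itv /= => /andP[rq qx].
    by exists (num q) => //; rewrite /A numK qx.
  move=> [n _]; rewrite /A; case: unnum => // q; case: ifP => // qx rq.
  exact: lt_trans rq qx.
have [_ _] := clopenable_sigma_algebra ray_separating c0; apply => n.
by rewrite /A; case: unnum => // q; case: ifP.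
Qed.
End code.

Lemma analyticT_real : analytic [set: R].
Proof. exact: analyticT_real_numbering (@pickleK rat). Qed.

End real.

(** * Finite powers *)

Section tuple.
Context d (Y : measurableType d).

Lemma separated_tuple n : separated Y -> separated (n.-tuple Y).
Proof.
move=> [K [G [mG sG]]].
exists ('I_n * K)%type, (fun k => (fun y => tnth y k.1) @^-1` G k.2); split.
  by move=> k; rewrite -[X in measurable X]setTI; apply: measurable_tnth.
move=> y z h; apply: eq_from_tnth => i; apply: sG => k.
exact: (h (i, k)).
Qed.

End tuple.

Lemma analyticT_tuple (R : realType) n : analytic [set: n.-tuple R].
Proof.
elim: n => [|n IH].
  rewrite (_ : setT = (fun=> [tuple]) @` [set: R]); last first.
    by apply/seteqP; split=> // y _; exists 0 => //; apply: eq_from_tnth => -[].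
  by apply: analytic_image; [exact: measurable_cst|exact: analyticT_real].
have aRn : analytic [set: R * n.-tuple R].
  apply: analyticT_prod => //; first exact: separated_real.
    exact/separated_tuple/separated_real.
  exact: analyticT_real.
have -> : [set: n.+1.-tuple R] =
    (fun z => [tuple of z.1 :: z.2]) @` [set: R * n.-tuple R].
  apply/seteqP; split=> // y _; exists (thead y, [tuple of behead y]) => //=.
  by rewrite -tuple_eta.
apply: analytic_image => //.
exact: (@measurable_cons _ _ _ _ fst _ snd measurable_fst measurable_snd).
Qed.

(** * Wealth processes *)

Section tuples.
Variable R : realType.

(** Truncation, or padding by 0. Being total, it stands for [prefix] with no bound on [t] to carry
    around. *)
Definition tuple_of_seq t (l : seq R) : t.-tuple R := [tuple nth 0 l i | i < t].

Lemma tuple_of_seqE t (l : seq R) : (t <= size l)%N ->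
  tuple_of_seq t l = take t l :> seq R.
Proof.
move=> tl; apply: (@eq_from_nth _ 0); first by rewrite size_tuple size_takel.
move=> i; rewrite size_tuple => it.
by rewrite -(tnth_nth 0 _ (Ordinal it)) tnth_mktuple nth_take.
Qed.

Lemma tuple_of_seqK t (x : t.-tuple R) : tuple_of_seq t x = x.
Proof.
by apply: val_inj; rewrite /= tuple_of_seqE ?take_oversize ?size_tuple.
Qed.

Lemma measurable_tuple_of_seq n t :
  measurable_fun setT (fun x : n.-tuple R => tuple_of_seq t x).
Proof.
apply/measurable_fun_tnthP => i.
have [ni|ni] := ltnP i n; last first.
  rewrite (_ : _ \o _ = fun=> 0); first exact: measurable_cst.
  by apply/funext => x /=; rewrite tnth_mktuple nth_default// size_tuple.
rewrite (_ : _ \o _ = fun x : n.-tuple R => tnth x (Ordinal ni)).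
  exact: measurable_tnth.
by apply/funext => x /=; rewrite tnth_mktuple (tnth_nth 0).
Qed.

Lemma measurable_rcons d (Y : measurableType d) t (f : Y -> t.-tuple R) (g : Y -> R) :
  measurable_fun setT f -> measurable_fun setT g ->
  measurable_fun setT (fun x => [tuple of rcons (f x) (g x)]).
Proof.
move=> mf mg; apply/measurable_fun_tnthP => i.
have [it|it] := ltnP i t.
  rewrite (_ : _ \o _ = (fun y => tnth y (Ordinal it)) \o f).
    by apply: measurableT_comp => //; exact: measurable_tnth.
  by apply/funext => x /=; rewrite !(tnth_nth 0)/= nth_rcons size_tuple it.
rewrite (_ : _ \o _ = g)//; apply/funext => x /=.
have -> : i = ord_max by apply/val_inj/eqP; rewrite eqn_leq it -ltnS ltn_ord.
by rewrite (tnth_nth 0)/= nth_rcons size_tuple ltnn eqxx.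
Qed.

Lemma cube_setT n : cube [set: R] n = setT.
Proof. exact/seteqP. Qed.

Variable X : set R.

Lemma measurable_cube n : measurable X -> measurable (cube X n).
Proof.
move=> mX.
rewrite (_ : cube X n = \bigcap_(i in [set: 'I_n]) (fun x => tnth x i) @^-1` X).
  apply: fin_bigcap_measurable; first exact: finite_finset.
  by move=> i _; rewrite -[X in measurable X]setTI; apply: measurable_tnth.
by apply/seteqP; split=> x h i => [_|]; [exact: h|exact: (h i I)].
Qed.

Lemma cube_nth n (x : n.-tuple R) i : cube X n x -> (i < n)%N -> X (nth 0 x i).
Proof. by move=> cx ni; rewrite -(tnth_nth 0 x (Ordinal ni)). Qed.

Lemma cube_tuple_of_seq n t (x : n.-tuple R) : (t <= n)%N -> cube X n x ->
  cube X t (tuple_of_seq t x).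
Proof.
move=> tn cx i; rewrite tnth_mktuple; apply: cube_nth => //.
exact: leq_trans tn.
Qed.

Lemma cube_rcons t (x : t.-tuple R) y : cube X t x -> X y ->
  cube X t.+1 [tuple of rcons x y].
Proof.
move=> cx Xy i; rewrite (tnth_nth 0)/= nth_rcons size_tuple.
case: ltnP => [it|it]; first exact: cube_nth.
have -> : i = ord_max by apply/val_inj/eqP; rewrite eqn_leq it -ltnS ltn_ord.
by rewrite eqxx.
Qed.

End tuples.

Section wealth.
Context (R : realType) (mu : R).
Implicit Types lam : nat -> seq R -> R.

(* [Elam] with the bets indexed by [nat] instead of [I_T], which avoids
   dependent types in inductions on the horizon. *)
Definition wealth lam t (l : seq R) : R :=
  \prod_(s < t) (1 + lam s (take s l) * (nth 0 l s - mu)).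

Lemma wealthS lam t l : wealth lam t.+1 l =
  wealth lam t l * (1 + lam t (take t l) * (nth 0 l t - mu)).
Proof. by rewrite /wealth big_ord_recr. Qed.

Lemma wealth_take lam t s l : (t <= s)%N -> wealth lam t (take s l) = wealth lam t l.
Proof.
move=> ts; apply: eq_bigr => i _; have is_ : (i < s)%N by apply: leq_trans ts.
by rewrite nth_take// take_takel// ltnW.
Qed.

Lemma wealth_rcons lam t (x : t.-tuple R) y :
  wealth lam t.+1 (rcons x y) = wealth lam t x * (1 + lam t x * (y - mu)).
Proof.
rewrite wealthS -cats1 -(wealth_take _ _ (leqnn t)) take_size_cat ?size_tuple//.
by rewrite nth_cat size_tuple ltnn subnn.
Qed.

Lemma eq_wealth lam lam' t l : (forall s, (s < t)%N -> lam s =1 lam' s) ->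
  wealth lam t l = wealth lam' t l.
Proof. by move=> e; apply: eq_bigr => i _; rewrite e. Qed.

Lemma measurable_wealth (X : set R) lam n t : measurable X ->
  (forall s, (s < t)%N -> measurable_fun (cube X s) (fun y : s.-tuple R => lam s y)) ->
  (t <= n)%N -> measurable_fun (cube X n) (fun x : n.-tuple R => wealth lam t x).
Proof.
move=> mX mlam tn.
have mcX k : measurable (cube X k) by exact: measurable_cube.
apply: measurable_prod => -[s st] _ /=.
apply: measurable_funD => //; apply: measurable_funM.
  rewrite (_ : (fun x : n.-tuple R => _) =
      (fun y : s.-tuple R => lam s y) \o
      (fun x : n.-tuple R => tuple_of_seq s x)); last first.
    apply/funext => x /=; rewrite tuple_of_seqE// size_tuple.
    exact: ltnW (leq_trans st tn).
  apply: (measurable_comp (mcX s)) (mlam s st) _.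
    move=> _ [x cx <-]; apply: cube_tuple_of_seq => //.
    exact: ltnW (leq_trans st tn).
  by apply: measurable_funTS; exact: measurable_tuple_of_seq.
apply: measurable_funB => //.
rewrite (_ : (fun x : n.-tuple R => _) = fun x => tnth x (Ordinal (leq_trans st tn))).
  by apply: measurable_funTS; exact: measurable_tnth.
by apply/funext => x; rewrite (tnth_nth 0).
Qed.

(** Averaging the inequality at the outcomes 0 and 1 with weights [1 - mu] and [mu] cancels the last
    bet, so by induction the wealths agree one round earlier. The outcomes 1 and 0 then compare the
    stakes in opposite directions. *)
Lemma wealth_maximal (X : set R) lam lam' t : 0 < mu < 1 -> X 0 -> X 1 ->
  (forall x : t.-tuple R, cube X t x -> wealth lam t x <= wealth lam' t x) ->
  forall x : t.-tuple R, cube X t x -> wealth lam t x = wealth lam' t x.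
Proof.
move=> /andP[mu0 mu1] X0 X1; elim: t => [|t IH] le_wealth x cx.
  by rewrite /wealth !big_ord0.
have slope (x' : t.-tuple R) y : cube X t x' -> X y ->
    wealth lam t x' + (wealth lam t x' * lam t x') * (y - mu) <=
    wealth lam' t x' + (wealth lam' t x' * lam' t x') * (y - mu).
  move=> cx' Xy; have := le_wealth _ (cube_rcons cx' Xy).
  by rewrite !wealth_rcons !mulrDr !mulr1 !mulrA.
have eq_t x' : cube X t x' -> wealth lam t x' = wealth lam' t x'.
  apply: IH => {}x' cx'.
  have h0 := slope _ _ cx' X0; have h1 := slope _ _ cx' X1.
  have {h0} : 0 <= (1 - mu) * (wealth lam' t x' + (wealth lam' t x' * lam' t x') * (0 - mu)
     - (wealth lam t x' + (wealth lam t x' * lam t x') * (0 - mu))).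
    by rewrite mulr_ge0 ?subr_ge0// ltW.
  have {h1} : 0 <= mu * (wealth lam' t x' + (wealth lam' t x' * lam' t x') * (1 - mu)
     - (wealth lam t x' + (wealth lam t x' * lam t x') * (1 - mu))).
    by rewrite mulr_ge0 ?subr_ge0// ltW.
  by lra.
have cx' : cube X t (tuple_of_seq t x) by apply: cube_tuple_of_seq.
rewrite !wealthS -(wealth_take lam _ (leqnn t)) -(wealth_take lam' _ (leqnn t)).
rewrite -tuple_of_seqE ?size_tuple//.
have h0 := slope _ _ cx' X0; have h1 := slope _ _ cx' X1.
rewrite (eq_t _ cx') in h0 h1 *; set y := nth 0 x t.
(* Only the stakes, wealth times bet, are determined: the bets may differ where the wealth
   vanishes. *)
suff e : wealth lam' t (tuple_of_seq t x) * lam t (tuple_of_seq t x) =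
         wealth lam' t (tuple_of_seq t x) * lam' t (tuple_of_seq t x).
  by rewrite !mulrDr !mulr1 !mulrN !mulrA e.
apply/eqP; rewrite eq_le; apply/andP; split.
  by move: h1; rewrite lerD2l ler_pM2r// subr_gt0.
by move: h0; rewrite lerD2l sub0r !mulrN lerN2 ler_pM2r.
Qed.

End wealth.

(** * Borel strategies from analytic constraints *)

(** [f x] is the supremum of [lo] and of the rationals [q] between [lo] and [hi] with [x] in [D q].
    The sets [D q] are chosen independently of one another, so only these one-sided estimates are
    available. *)
Lemma measurable_cut d (Y : measurableType d) (R : realType) (lo hi : R)
    (D : rat -> set Y) : lo <= hi -> (forall q, measurable (D q)) ->
  exists f : Y -> R, [/\ measurable_fun setT f, forall x, lo <= f x <= hi,
    forall x q, lo <= ratr q <= hi -> D q x -> ratr q <= f x &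
    forall x c, lo <= c -> (forall q, D q x -> ratr q <= c) -> f x <= c].
Proof.
move=> lohi mD.
pose h n x : R := if unpickle n is Some q then
  if (lo <= ratr q <= hi) && (x \in D q) then ratr q else lo else lo.
have h_bnd n x : lo <= h n x <= hi.
  rewrite /h; case: unpickle => [q|]; last by rewrite lexx.
  by case: ifP => [/andP[]//|_]; rewrite lexx.
have hub x : has_ubound (range (h^~ x)).
  by exists hi => _ [n _ <-]; have /andP[] := h_bnd n x.
have supsE x : sups (h^~ x) 0 = sup (range (h^~ x)).
  by rewrite /sups /=; congr sup; apply/seteqP; split=> _ [n _ <-]; exists n.
exists (fun x => sups (h^~ x) 0); split.
- apply: measurable_fun_sups => [x _|n]; first exact: hub.
  rewrite /h; case: unpickle => [q|]; last exact: measurable_cst.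
  case: (lo <= ratr q <= hi) => /=; last exact: measurable_cst.
  apply: measurable_fun_ifT; try exact: measurable_cst.
  apply: (measurable_fun_bool true); rewrite setTI.
  rewrite (_ : _ @^-1` _ = D q) //; apply/seteqP; split=> x.
    exact: set_mem.
  exact: mem_set.
- move=> x; rewrite supsE; apply/andP; split.
    apply: le_trans (ub_le_sup (hub x) _); last by exists 0%N.
    by have /andP[] := h_bnd 0%N x.
  apply: ge_sup; first by exists (h 0%N x), 0%N.
  by move=> _ [n _ <-]; have /andP[] := h_bnd n x.
- move=> x q qI Dx; rewrite supsE; apply: (ub_le_sup (hub x)).
  by exists (pickle q) => //; rewrite /h pickleK qI mem_set.
- move=> x c loc hc; rewrite supsE; apply: ge_sup; first by exists (h 0%N x), 0%N.
  move=> _ [n _ <-]; rewrite /h; case: unpickle => // q.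
  by case: ifP => // /andP[_]; rewrite in_setE => /hc.
Qed.

(** A strict inequality at [l] survives a small increase of the argument. The denominator [m + 1] in
    [e] allows [m] to be 0. *)
Lemma rat_above_affine (R : realType) (c m b l h : R) : 0 <= m ->
  c + l * m < b -> l < h -> exists q : rat, l < ratr q < h /\ c + ratr q * m < b.
Proof.
move=> m0 lb lh.
pose e := (b - (c + l * m)) / (m + 1).
have m1 : 0 < m + 1 by rewrite ltr_wpDl.
have e0 : 0 < e by rewrite divr_gt0// subr_gt0.
have [|q] := @rat_in_itvoo R l (Num.min h (l + e)).
  by rewrite lt_min lh ltrDl e0.
rewrite in_itv /= lt_min => /and3P[lq qh qe]; exists q; split; first by rewrite lq.
have : (ratr q - l) * (m + 1) < e * (m + 1) by rewrite ltr_pM2r// ltrBlDl.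
by rewrite /e divfK ?gt_eqF//; lra.
Qed.

Section majorise.
Context (R : realType) (X : set R) (mu : R).
Hypotheses (mX : measurable X) (X0 : X 0) (X1 : X 1) (X01 : X `<=` `[0, 1]).
Hypotheses (mu0 : 0 < mu) (mu1 : mu < 1).

(* An element [(x, a)] of [H] is the constraint "the wealth at [x] is at least
   [a]"; [step H] gathers the constraints that [H] imposes one round earlier,
   through the distributions with mean [mu] carried by at most two points. *)
Definition step t (H : set (t.+1.-tuple R * R)) : set (t.-tuple R * R) :=
  [set v : t.-tuple R * R | exists y z w a b : R, [/\ X y, X z & 0 <= w <= 1] /\
    [/\ w * y + (1 - w) * z = mu, H ([tuple of rcons v.1 y], a),
        H ([tuple of rcons v.1 z], b) & v.2 = w * a + (1 - w) * b]].

(** The weights with mean [mu] on [y < mu < z] are [(z - mu) / (z - y)] and [(mu - y) / (z - y)];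
    denominators are cleared in the conclusion. *)
Lemma step_two_point t (H : set (t.+1.-tuple R * R)) (x : t.-tuple R) u y z a b :
  (forall c, step H (x, c) -> c <= u) -> X y -> X z -> y < mu -> mu < z ->
  H ([tuple of rcons x y], a) -> H ([tuple of rcons x z], b) ->
  (z - mu) * a + (mu - y) * b <= (z - y) * u.
Proof.
move=> hu Xy Xz ymu muz Ha Hb.
have zy : 0 < z - y by lra.
have zy0 : z - y != 0 by rewrite gt_eqF.
pose w := (z - mu) / (z - y).
have w1 : 1 - w = (mu - y) / (z - y) by rewrite /w; field.
have : w * a + (1 - w) * b <= u.
  apply: hu; exists y, z, w, a, b; split; first split=> //.
    by rewrite /w divr_ge0 ?ler_pdivrMr//; lra.
  by split => //; rewrite w1 /w; field.
rewrite w1 /w -(ler_pM2l zy); congr (_ <= _); field.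
exact: zy0.
Qed.

Lemma step_ge0 t (H : set (t.+1.-tuple R * R)) :
  (forall x, cube X t.+1 x -> H (x, 0)) ->
  forall x, cube X t x -> step H (x, 0).
Proof.
move=> H0 x cx; exists 1, 0, mu, 0, 0; split; split => //=.
- by rewrite !ltW.
- by rewrite mulr1 mulr0 addr0.
- by apply: H0; apply: (cube_rcons cx).
- by apply: H0; apply: (cube_rcons cx).
- by rewrite !mulr0 addr0.
Qed.

Let separatedRn t : separated (t.-tuple R).
Proof. exact/separated_tuple/separated_real. Qed.

Let separatedRnR t : separated (t.-tuple R * R)%type.
Proof. by apply: separated_prod; [exact: separatedRn|exact: separated_real]. Qed.

Let analyticRnR t : analytic [set: t.-tuple R * R].
Proof.
apply: analyticT_prod; [exact: separatedRn|exact: separated_real| |].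
  exact: analyticT_tuple.
exact: analyticT_real.
Qed.

Ltac meas := repeat match goal with
  | |- measurable_fun _ (fun x => (@?f x, @?g x)) => apply: measurable_fun_pair
  | |- measurable_fun _ (fun x => [tuple of rcons (@?f x) (@?g x)]) =>
      apply: measurable_rcons
  | |- measurable_fun _ (fun x => @?f x - @?g x) => apply: measurable_funB
  | |- measurable_fun _ (fun x => @?f x + @?g x) => apply: measurable_funD
  | |- measurable_fun _ (fun x => @?f x * @?g x) => apply: measurable_funM
  | |- measurable_fun _ fst => exact: measurable_fst
  | |- measurable_fun _ snd => exact: measurable_snd
  | |- measurable_fun _ (fun x => x.1) => exact: measurable_fst
  | |- measurable_fun _ (fun x => x.2) => exact: measurable_snd
  | |- measurable_fun _ (fun x => (@?f x).1) =>
      apply: (measurableT_comp measurable_fst)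
  | |- measurable_fun _ (fun x => (@?f x).2) =>
      apply: (measurableT_comp measurable_snd)
  | |- measurable_fun _ _ => exact: measurable_cst
  end.

Let preimage_measurable d d' (Y : measurableType d) (Z : measurableType d')
  (f : Y -> Z) (B : set Z) : measurable_fun setT f -> measurable B ->
  measurable (f @^-1` B).
Proof. by move=> mf mB; rewrite -[X in measurable X]setTI; apply: mf. Qed.

(** [step H] is a projection: the outcomes, the weight and the levels become coordinates of [Z],
    where all conditions are Borel except the two memberships in [H]. *)
Lemma analytic_step t (H : set (t.+1.-tuple R * R)) :
  analytic H -> analytic (step H).
Proof.
move=> aH.
pose Z : measurableType _ := (t.-tuple R * R * (R * R) * (R * R))%type.
pose D := [set v : Z | [/\ X v.1.1.2, X v.1.2.1 & 0 <= v.1.2.2 <= 1] /\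
  v.1.2.2 * v.1.1.2 + (1 - v.1.2.2) * v.1.2.1 = mu].
pose g1 (v : Z) := ([tuple of rcons v.1.1.1 v.1.1.2], v.2.1).
pose g2 (v : Z) := ([tuple of rcons v.1.1.1 v.1.2.1], v.2.2).
pose f (v : Z) := (v.1.1.1, v.1.2.2 * v.2.1 + (1 - v.1.2.2) * v.2.2).
have -> : step H = f @` (D `&` g1 @^-1` H `&` g2 @^-1` H).
  apply/seteqP; split=> [[x q] [y [z [w [a [b [[Xy Xz w01] [e Ha Hb /= ->]]]]]]]|].
    by exists (x, y, (z, w), (a, b)) => //; split => //; split.
  move=> _ [[[[x y] [z w]] [a b]] [[[[Xy Xz w01] e] Ha] Hb] <-].
  by exists y, z, w, a, b; split.
have aZ : analytic [set: Z].
  have sR := separated_real R; have aR := @analyticT_real R.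
  have sRR := separated_prod sR sR; have aRR := analyticT_prod sR sR aR aR.
  have sY := separated_prod (separatedRnR t) sRR.
  apply: (analyticT_prod sY sRR _ aRR).
  exact: (analyticT_prod (separatedRnR t) sRR (@analyticRnR t) aRR).
have mD : measurable D.
  have -> : D = (fun v : Z => v.1.1.2) @^-1` X `&` (fun v : Z => v.1.2.1) @^-1` X
     `&` (fun v : Z => v.1.2.2) @^-1` `[0, 1] `&`
     (fun v : Z => v.1.2.2 * v.1.1.2 + (1 - v.1.2.2) * v.1.2.1) @^-1` [set mu].
    apply/seteqP; split=> v /=; rewrite in_itv /=.
      by move=> [[? ? ?] ?].
    by move=> [[[? ?] ?] ?].
  repeat apply: measurableI; apply: preimage_measurable => //; by meas.
apply: analytic_image; first by rewrite /f; meas.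
have mg1 : measurable_fun setT g1 by rewrite /g1; meas.
have mg2 : measurable_fun setT g2 by rewrite /g2; meas.
apply: (analytic_setI_preimage mg2 (separatedRnR _)) => //.
apply: (analytic_setI_preimage mg1 (separatedRnR _)) => //.
exact: measurable_analytic.
Qed.

(** Once pulled back to round 0, the constraints ask for no more than the initial wealth 1. *)
Fixpoint bounded t : set (t.-tuple R * R) -> Prop :=
  if t is t'.+1 then fun H => bounded (step H)
  else fun H => forall v, H v -> v.2 <= 1.

(** With [S] above [mu], these are the pasts for which the bet [l] is too small given the wealth
    [u]; with [S] below [mu], those for which it is too large. *)
Let analytic_exceed t (H : set (t.+1.-tuple R * R)) (u : t.-tuple R -> R)
    (S : set R) (l : R) :
  analytic H -> measurable_fun setT u -> measurable S ->
  analytic [set x : t.-tuple R | cube X t x /\ exists z b : R, [/\ X z, S z,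
    H ([tuple of rcons x z], b) & u x * (1 + l * (z - mu)) < b]].
Proof.
move=> aH mu_ mS.
pose Z : measurableType _ := (t.-tuple R * (R * R))%type.
pose D := [set v : Z | cube X t v.1 /\ [/\ X v.2.1, S v.2.1 &
  u v.1 * (1 + l * (v.2.1 - mu)) < v.2.2]].
pose g (v : Z) := ([tuple of rcons v.1 v.2.1], v.2.2).
rewrite (_ : [set x | _] = fst @` (D `&` g @^-1` H)); last first.
  apply/seteqP; split=> [x [cx [z [b [Xz Sz Hb ub]]]]|].
    by exists (x, (z, b)).
  by move=> _ [[x [z b]] [[cx [Xz Sz ub]] Hb] <-]; split=> //; exists z, b.
have mcX : measurable (cube X t) by exact: measurable_cube.
have mux : measurable_fun setT (fun v : Z => u v.1).
  by apply: measurableT_comp => //; exact: measurable_fst.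
have mD : measurable D.
  have -> : D = fst @^-1` cube X t `&` ((fun v : Z => v.2.1) @^-1` (X `&` S) `&`
     (fun v : Z => v.2.2 - u v.1 * (1 + l * (v.2.1 - mu))) @^-1` `]0, +oo[).
    apply/seteqP; split=> v /=; rewrite in_itv /= andbT subr_gt0.
      by move=> [? [? ? ?]].
    by move=> [? [[? ?] ?]].
  apply: measurableI; first by apply: preimage_measurable => //; meas.
  apply: measurableI; first by apply: preimage_measurable; [meas|exact: measurableI].
  apply: preimage_measurable => //.
  apply: measurable_funB; first by meas.
  by apply: measurable_funM => //; meas.
apply: analytic_image; first exact: measurable_fst.
have mg : measurable_fun setT g by rewrite /g; meas.
apply: (analytic_setI_preimage mg (separatedRnR _)) => //.
apply: measurable_analytic => //; apply: analyticT_prod.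
- exact: separatedRn.
- by apply: separated_prod; exact: separated_real.
- exact: analyticT_tuple.
by apply: analyticT_prod; (exact: separated_real || exact: analyticT_real).
Qed.

(** Induction on [t]: the strategy for [step H] yields the wealth [u] before the last round, and the
    last bet [f] is cut out by the sets [D q]. A constraint violated by [f x] would also be violated
    by a nearby rational bet, against the choice of [D]; at the ends of [I_mu], a two-point
    distribution charging 0 or 1 is used instead. *)
Lemma wealth_majorises t (H : set (t.-tuple R * R)) : analytic H ->
  (forall x, cube X t x -> H (x, 0)) -> bounded H ->
  exists lam : nat -> seq R -> R,
    [/\ forall s, measurable_fun setT (fun y : s.-tuple R => lam s y),
        forall s l, Imu mu (lam s l) &
        forall x a, cube X t x -> H (x, a) -> a <= wealth mu lam t x].
Proof.
pose lo := (mu - 1)^-1; pose hi := mu^-1.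
have lo0 : lo < 0 by rewrite invr_lt0 subr_lt0.
have hi0 : 0 < hi by rewrite invr_gt0.
have lohi : lo <= hi by rewrite ltW// (lt_trans lo0).
elim: t H => [|t IH] H aH H0 bH.
  exists (fun _ _ => 0); split.
  - by move=> s; exact: measurable_cst.
  - by move=> s l; rewrite /Imu /= in_itv /= !ltW.
  - by move=> x a _ /bH; rewrite /wealth big_ord0.
have [lam [mlam lamI le_u]] := IH _ (analytic_step aH) (step_ge0 H0) bH.
pose u (x : t.-tuple R) := wealth mu lam t x.
have mu_ : measurable_fun setT u.
  rewrite -(cube_setT R t); apply: (measurable_wealth _ (X := setT)) => //.
  by move=> s _; rewrite cube_setT.
pose exceed (S : set R) (q : rat) := [set x : t.-tuple R | cube X t x /\
  exists z b : R, [/\ X z, S z, H ([tuple of rcons x z], b) &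
    u x * (1 + ratr q * (z - mu)) < b]].
have sep q : exists D, [/\ measurable D, exceed `]mu, +oo[%classic q `<=` D &
    exceed `]-oo, mu[%classic q `<=` ~` D].
  have [||||D mD [AD BD]] := @lusin_separation _ (t.-tuple R)
    (exceed `]mu, +oo[%classic q) (exceed `]-oo, mu[%classic q); last by exists D.
  - exact: separatedRn.
  - exact: analytic_exceed.
  - exact: analytic_exceed.
  (* A bet too small at [z > mu] and too large at [y < mu] would contradict the two-point constraint
     on [u x]. *)
  apply/seteqP; split=> // x [[cx [z [b [Xz /= + Hb hb]]]]].
  rewrite in_itv /= andbT => muz [_ [y [a [Xy /=]]]].
  rewrite in_itv /= => ymu Ha ha.
  have := step_two_point (fun c => le_u x c cx) Xy Xz ymu muz Ha Hb.
  rewrite -/(u x) => hab.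
  have : 0 < (z - mu) * (a - u x * (1 + ratr q * (y - mu))).
    by rewrite mulr_gt0 ?subr_gt0.
  have : 0 < (mu - y) * (b - u x * (1 + ratr q * (z - mu))).
    by rewrite mulr_gt0 ?subr_gt0.
  by lra.
have [D hD] := choice sep.
have [f [mf fI f_ge f_le]] : exists f : t.-tuple R -> R,
  [/\ measurable_fun setT f, forall x, lo <= f x <= hi,
    forall x q, lo <= ratr q <= hi -> D q x -> ratr q <= f x &
    forall x c, lo <= c -> (forall q, D q x -> ratr q <= c) -> f x <= c].
  by apply: measurable_cut => // q; have [] := hD q.
exists (fun s l => if s == t then f (tuple_of_seq t l) else lam s l); split.
- move=> s; case: eqP => [->|_]; last exact: mlam.
  by under eq_fun do rewrite tuple_of_seqK.
- move=> s l; case: eqP => _; last exact: lamI.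
  by rewrite /Imu /= in_itv /= fI.
move=> xz b cxz Hxz.
pose x := tuple_of_seq t xz; pose z := nth 0 xz t.
have xzE : xz = [tuple of rcons x z].
  apply/val_inj; rewrite /= tuple_of_seqE ?size_tuple// -take_nth ?size_tuple//.
  by rewrite take_oversize// size_tuple.
have cx : cube X t x by apply: cube_tuple_of_seq.
have Xz : X z by apply: cube_nth cxz _.
have Hb : H ([tuple of rcons x z], b) by rewrite -xzE.
rewrite [X in wealth _ _ _ X](_ : _ = rcons x z); last by rewrite {1}xzE.
rewrite wealth_rcons eqxx tuple_of_seqK.
rewrite (@eq_wealth _ _ _ lam); last first.
  by move=> s st l; rewrite ltn_eqF.
rewrite -/(u x).
have u0 : 0 <= u x by apply: le_u => //; exact: step_ge0.
have two := step_two_point (fun c => le_u x c cx).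
have Hx0 : H ([tuple of rcons x 0], 0) by apply: H0; apply: (cube_rcons cx).
have Hx1 : H ([tuple of rcons x 1], 0) by apply: H0; apply: (cube_rcons cx).
rewrite leNgt; apply/negP => ub.
have /andP[lof fhi] := fI x.
have [zmu|muz|zmu] := ltgtP z mu.
(* Here [f x] is too large. So is some rational [- q] below it, hence every larger rational, and [D]
   selects none of these. The signs are reversed to apply [rat_above_affine]. *)
- have [lf|fl] := ltP lo (f x).
    have [|||q [/andP[]]] := @rat_above_affine R (u x) (u x * (mu - z)) b (- f x) (- lo).
    + by rewrite mulr_ge0// subr_ge0 ltW.
    + by move: ub; lra.
    + by rewrite ltrN2.
    rewrite ltrNl ltrNr => qf loq qb.
    have qE : - ratr q = ratr (- q) :> R by rewrite rmorphN.
    suff : f x <= - ratr q by rewrite leNgt qf.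
    apply: f_le; first exact: ltW.
    move=> p Dp; rewrite leNgt; apply/negP => qp.
    have [_ _ /(_ x)] := hD p; apply => //; split=> //; exists z, b; split => //=.
    have : 0 <= (u x * (mu - z)) * (ratr p - - ratr q).
      by rewrite !mulr_ge0// subr_ge0 ltW.
    by move: qb; lra.
  (* The bet [lo] leaves nothing at the outcome 1. Pairing [z] with 1, where the level is 0, gives
     exactly the required bound. *)
  have fE : f x = lo by apply/eqP; rewrite eq_le fl lof.
  have := two _ _ _ _ Xz X1 zmu mu1 Hb Hx1.
  have -> : (1 - z) * u x = (1 - mu) * (u x * (1 + f x * (z - mu))).
    rewrite fE /lo; field; by rewrite subr_eq0 lt_eqF.
  by rewrite mulr0 addr0 ler_pM2l ?subr_gt0// leNgt ub.
(* Symmetrically, [f x] is too small here, and the bet [hi] leaves nothing at the outcome 0. *)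
- have [fh|hf] := ltP (f x) hi.
    have [|||q [/andP[fq qhi] qb]] := @rat_above_affine R (u x) (u x * (z - mu)) b (f x) hi.
    + by rewrite mulr_ge0// subr_ge0 ltW.
    + by move: ub; lra.
    + by [].
    suff : ratr q <= f x by rewrite leNgt fq.
    apply: f_ge; first by rewrite (ltW qhi) (le_trans lof (ltW fq)).
    have [_ + _] := hD q; apply; split => //; exists z, b; split => //=.
      by rewrite in_itv /= andbT.
    by move: qb; lra.
  have fE : f x = hi by apply/eqP; rewrite eq_le fhi hf.
  have := two _ _ _ _ X0 Xz mu0 muz Hx0 Hb.
  have -> : (z - 0) * u x = (mu - 0) * (u x * (1 + f x * (z - mu))).
    by rewrite fE /hi; field; rewrite gt_eqF.
  by rewrite mulr0 add0r ler_pM2l ?subr_gt0// leNgt ub.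
(* At [mu] the bet has no effect, and the point mass there is an admissible step, of weight 1. *)
- move: ub; rewrite zmu subrr mulr0 addr0 mulr1 ltNge => /negP; apply.
  apply: le_u => //; exists mu, mu, 1, b, b; rewrite -zmu; split; split => //.
  + by rewrite ler01 lexx.
  + by ring.
  + by rewrite /=; ring.
Qed.

End majorise.

(** * Expectations *)

Section weighted_integral.
Context d d' (Y : measurableType d) (Z : measurableType d') (R : realType).
Variables (P : {measure set Y -> \bar R}) (p : Y -> Z) (D : set Y).
Hypotheses (mp : measurable_fun setT p) (mD : measurable D).
Variables (f : Y -> R) (c : R).
Hypotheses (mf : measurable_fun D f) (f0 : forall x, D x -> 0 <= f x).
Hypothesis intf : forall B, measurable B ->
  (\int[P]_(x in D `&` p @^-1` B) (f x)%:E = c%:E * P (D `&` p @^-1` B))%E.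

Import HBNNSimple.

Let mpre B : measurable B -> measurable (p @^-1` B).
Proof. by move=> mB; rewrite -[X in measurable X]setTI; apply: mp. Qed.

Lemma integral_nnsfun_weight (h : {nnsfun Z >-> R}) :
  (\int[P]_(x in D) ((h (p x))%:E * (f x)%:E) =
   \sum_(r \in range h) (r%:E * (c%:E * P (D `&` p @^-1` (h @^-1` [set r])))))%E.
Proof.
transitivity (\int[P]_(x in D) (\sum_(r \in range h)
    ((r%:E * (\1_(h @^-1` [set r]) (p x))%:E) * (f x)%:E)))%E.
  apply: eq_integral => x _.
  rewrite -ge0_mule_fsuml => [|r]; last exact: nnfun_muleindic_ge0.
  by under eq_fsbigr do rewrite -EFinM; rewrite fsumEFin// -fimfunE.
have mh r : measurable (h @^-1` [set r]) by [].
have mi r : measurable_fun D (fun x => (\1_(h @^-1` [set r]) (p x))%:E : \bar R).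
  apply/measurable_EFinP; apply: measurable_funTS.
  by apply: measurableT_comp => //; exact: measurable_indic.
have mfE : measurable_fun D (fun x => (f x)%:E) by exact/measurable_EFinP.
rewrite ge0_integral_fsum//; last 2 first.
- move=> r; apply: emeasurable_funM => //.
  by apply: emeasurable_funM => //; exact: measurable_cst.
- by move=> r x Dx; rewrite mule_ge0 ?nnfun_muleindic_ge0// lee_fin f0.
apply: eq_fsbigr => r; rewrite inE => -[z _ rE].
under eq_integral do rewrite -muleA.
rewrite ge0_integralZl//; last 3 first.
- exact: emeasurable_funM.
- by move=> x Dx; rewrite mule_ge0 ?lee_fin ?f0.
- by rewrite lee_fin -rE.
rewrite -intf// integral_mkcondr; congr (_ * _)%E; apply: eq_integral => x _.
by rewrite epatch_indic /= muleC.
Qed.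

End weighted_integral.

Section weighted_integral_eq.
Context d d' (Y : measurableType d) (Z : measurableType d') (R : realType).
Variables (P : {measure set Y -> \bar R}) (p : Y -> Z) (D : set Y) (E : set Z).
Hypotheses (mp : measurable_fun setT p) (mD : measurable D) (mE : measurable E).
Hypothesis DE : D `<=` p @^-1` E.

Import HBNNSimple.

(** Taking out what is known: on [D], [f] has constant conditional mean [c] given [p]. Simple
    weights come first, then monotone convergence. *)
Lemma ge0_integral_weight (f : Y -> R) (c : R) (G : Z -> R) :
  measurable_fun D f -> (forall x, D x -> 0 <= f x) -> 0 <= c ->
  (forall B, measurable B ->
    \int[P]_(x in D `&` p @^-1` B) (f x)%:E = c%:E * P (D `&` p @^-1` B))%E ->
  measurable_fun E G -> (forall z, E z -> 0 <= G z) ->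
  (\int[P]_(x in D) (G (p x) * f x)%:E = c%:E * \int[P]_(x in D) (G (p x))%:E)%E.
Proof.
move=> mf f0 c0 intf mG G0.
have mGE : measurable_fun E (EFin \o G) by exact/measurable_EFinP.
pose g := nnsfun_approx mE mGE.
have lim_weight (w : Y -> R) : measurable_fun D w -> (forall x, D x -> 0 <= w x) ->
    (\int[P]_(x in D) ((g n (p x))%:E * (w x)%:E) @[n --> \oo] -->
    \int[P]_(x in D) (G (p x) * w x)%:E)%E.
  move=> mw w0.
  rewrite (_ : (\int[P]_(x in D) (G (p x) * w x)%:E =
      \int[P]_(x in D) limn (fun n => (g n (p x))%:E * (w x)%:E))%E); last first.
    apply: eq_integral => x /[!inE] Dx; apply/esym/cvg_lim => //.
    rewrite EFinM; apply: cvgeZr => //.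
    by apply: (cvg_nnsfun_approx mE mGE) => [z Ez|]; [rewrite lee_fin G0|exact: DE].
  apply: cvg_monotone_convergence => //.
  - move=> n; apply: emeasurable_funM; last exact/measurable_EFinP.
    apply/measurable_EFinP/measurable_funTS.
    by apply: measurableT_comp.
  - by move=> n x Dx; rewrite mule_ge0// lee_fin ?w0.
  - move=> x Dx a b ab; rewrite lee_wpmul2r ?lee_fin ?w0//.
    exact/lefP/nd_nnsfun_approx.
have lim1 := lim_weight f mf f0.
(* The right-hand side is the case where [f] is the constant 1. *)
have lim2 := lim_weight (cst 1) (measurable_cst _) (fun _ _ => ler01).
have {lim2} := cvgeZl (y := c%:E) isT lim2.
under [X in _ --> (_ * X)%E]eq_integral do rewrite mulr1.
move=> lim2; rewrite -(cvg_lim _ lim1)// -(cvg_lim _ lim2)//.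
congr (limn _); apply/funext => n.
rewrite (integral_nnsfun_weight mp mD mf f0 intf).
rewrite (integral_nnsfun_weight (c := 1) mp mD (measurable_cst _) (fun _ _ => ler01)).
  rewrite ge0_mule_fsumr; last first.
    move=> r; have [r0|r0] := leP 0 r; first by rewrite !mule_ge0 ?lee_fin.
    rewrite (_ : g n @^-1` [set r] = set0); last first.
      by apply/seteqP; split=> // z /= gr; move: r0; rewrite -gr ltNge fun_ge0.
    by rewrite preimage_set0 setI0 measure0 !mule0.
  by apply: eq_fsbigr => r _; rewrite mul1e muleCA.
move=> B mB; apply: (integral_cst P _ 1%E); apply: measurableI => //.
by rewrite -[X in measurable X]setTI; apply: mp.
Qed.

End weighted_integral_eq.

(** * Mean wealth under the hypothesis *)

Section expectation.
Context (R : realType) (X : set R) (T : nat) (mu : R).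
Hypotheses (mX : measurable X) (X01 : X `<=` `[0, 1]).
Hypotheses (mu0 : 0 < mu) (mu1 : mu < 1).

Lemma prefixE (t : 'I_T) (x : T.-tuple R) : Defs.prefix T t x = tuple_of_seq t x.
Proof. by apply: eq_from_tnth => i; rewrite !tnth_mktuple (tnth_nth 0). Qed.

Let mcX n : measurable (cube X n). Proof. exact: measurable_cube. Qed.

Let cube01 n (x : n.-tuple R) i : cube X n x -> 0 <= tnth x i <= 1.
Proof. by move=> /(_ i)/X01; rewrite /= in_itv. Qed.

Lemma integrable_coord (P : probability (T.-tuple R) R) (t : 'I_T) D :
  measurable D -> D `<=` cube X T ->
  P.-integrable D (fun x : T.-tuple R => (tnth x t)%:E).
Proof.
move=> mD DX.
have i1 : P.-integrable D (EFin \o cst 1) by exact: finite_measure_integrable_cst.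
apply: (le_integrable mD _ _ i1).
  by apply/measurable_EFinP; apply: measurable_funTS; exact: measurable_tnth.
move=> x /DX /(cube01 t) /andP[x0 x1]; rewrite lee_fin !ger0_norm//.
Qed.

(** The outcome and its complement to 1 are both nonnegative, as [ge0_integral_weight] requires. *)
Lemma integral_coord (P : probability (T.-tuple R) R) : Hmu X T mu P ->
  forall (t : 'I_T) (B : set (t.-tuple R)), measurable B ->
  let D := cube X T `&` (fun x : T.-tuple R => tuple_of_seq t x) @^-1` B in
  (\int[P]_(x in D) (tnth x t)%:E = mu%:E * P D /\
   \int[P]_(x in D) (1 - tnth x t)%:E = (1 - mu)%:E * P D)%E.
Proof.
move=> [_ HP] t B mB D.
have mD : measurable D.
  apply: measurableI => //; rewrite -[X in measurable X]setTI.
  exact: measurable_tuple_of_seq.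
have PD : P D \is a fin_num by exact: fin_num_measure.
have icst r : P.-integrable D (EFin \o cst r) by exact: finite_measure_integrable_cst.
have ix := integrable_coord P t mD (@subIsetl _ _ _).
have ecst r : (\int[P]_(x in D) (EFin \o cst r) x = r%:E * P D)%E.
  exact: (integral_cst P mD r%:E).
have ex : (\int[P]_(x in D) (tnth x t)%:E = mu%:E * P D)%E.
  have := HP t B mB.
  rewrite (_ : Defs.prefix T t = fun x => tuple_of_seq t x); last first.
    by apply/funext => x; exact: prefixE.
  rewrite -/D (integralB_EFin (f1 := fun x => tnth x t) (f2 := cst mu) mD ix (icst mu)).
  rewrite ecst -(fineK (integrable_fin_num mD ix)) -(fineK PD) -EFinM -EFinB.
  by move=> -[/eqP]; rewrite subr_eq0 => /eqP ->.
split=> //.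
under eq_integral do rewrite EFinB.
rewrite (integralB_EFin (f1 := cst 1) (f2 := fun x => tnth x t) mD (icst 1) ix).
rewrite ecst ex -(fineK PD) -!EFinM -EFinB.
by congr EFin; ring.
Qed.

(** Each end of [I_mu] is the bet at which one payoff vanishes: [mu^-1] for the outcome 0,
    [(mu - 1)^-1] for the outcome 1. *)
Lemma payoff_ge0 l : Imu mu l -> 0 <= 1 - l * mu /\ 0 <= 1 + l * (1 - mu).
Proof.
rewrite /Imu /= in_itv /= => /andP[lo hi].
split; first by rewrite subr_ge0 -ler_pdivlMr// div1r.
have : (mu - 1)^-1 * (1 - mu) <= l * (1 - mu) by rewrite ler_wpM2r// subr_ge0 ltW.
have -> : (mu - 1)^-1 * (1 - mu) = -1 by field; rewrite subr_eq0 lt_eqF.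
by lra.
Qed.

Lemma wealth_ge0 (lam : nat -> seq R -> R) s (y : s.-tuple R) :
  (forall s (y : s.-tuple R), (s < T)%N -> cube X s y -> Imu mu (lam s y)) ->
  (s <= T)%N -> cube X s y -> 0 <= wealth mu lam s y.
Proof.
move=> lamI sT cy; apply: prodr_ge0 => i _.
have iT : (i < T)%N by exact: leq_trans sT.
have [|r0 p0] := payoff_ge0 (lamI i (tuple_of_seq i y) iT _).
  by apply: cube_tuple_of_seq => //; exact: ltnW.
move: r0 p0; rewrite tuple_of_seqE ?size_tuple 1?ltnW//.
have := cube01 i cy; rewrite (tnth_nth 0); set l := lam _ _; set z := nth _ _ _.
move=> /andP[z0 z1] r0 p0.
have -> : 1 + l * (z - mu) = (1 - z) * (1 - l * mu) + z * (1 + l * (1 - mu)) by ring.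
by rewrite addr_ge0// mulr_ge0// subr_ge0.
Qed.

(** The last round splits the wealth into [low] times [1 - X] plus [high] times [X], where [low] and
    [high] are nonnegative functions of the past. Conditional means replace [X] by [mu], and
    [(1 - mu) low + mu high] is the previous wealth. *)
Lemma integral_wealth (P : probability (T.-tuple R) R) (lam : nat -> seq R -> R) t :
  Hmu X T mu P ->
  (forall s, (s < T)%N -> measurable_fun (cube X s) (fun y : s.-tuple R => lam s y)) ->
  (forall s (y : s.-tuple R), (s < T)%N -> cube X s y -> Imu mu (lam s y)) ->
  (t <= T)%N ->
  (\int[P]_(x in cube X T) (wealth mu lam t x)%:E = 1)%E.
Proof.
move=> HP mlam lamI.
have w0 s (y : s.-tuple R) : (s <= T)%N -> cube X s y -> 0 <= wealth mu lam s y.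
  exact: wealth_ge0.
elim: t => [_|t IH tT].
  under eq_integral do rewrite /wealth big_ord0.
  transitivity (1 * P (cube X T))%E; first exact: (integral_cst P (@mcX T) 1%E).
  by rewrite (proj1 HP) mule1.
rewrite -(IH (ltnW tT)).
pose o := Ordinal tT.
pose low (y : t.-tuple R) := wealth mu lam t y * (1 - lam t y * mu).
pose high (y : t.-tuple R) := wealth mu lam t y * (1 + lam t y * (1 - mu)).
have mpre : measurable_fun setT (fun x : T.-tuple R => tuple_of_seq t x).
  exact: measurable_tuple_of_seq.
have mwealth : measurable_fun (cube X t) (fun y : t.-tuple R => wealth mu lam t y).
  by apply: measurable_wealth => // s st; apply: mlam; exact: (ltn_trans st tT).
have mlow : measurable_fun (cube X t) low.
  apply: measurable_funM => //; apply: measurable_funB => //.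
  by apply: measurable_funM => //; exact: mlam.
have mhigh : measurable_fun (cube X t) high.
  apply: measurable_funM => //; apply: measurable_funD => //.
  by apply: measurable_funM => //; exact: mlam.
have low0 y : cube X t y -> 0 <= low y.
  move=> cy; have [? ?] := payoff_ge0 (lamI t y tT cy).
  by apply: mulr_ge0 => //; apply: w0 => //; exact: ltnW.
have high0 y : cube X t y -> 0 <= high y.
  move=> cy; have [? ?] := payoff_ge0 (lamI t y tT cy).
  by apply: mulr_ge0 => //; apply: w0 => //; exact: ltnW.
have pre_cube : cube X T `<=` (fun x : T.-tuple R => tuple_of_seq t x) @^-1` cube X t.
  by move=> x cx; apply: cube_tuple_of_seq => //; exact: ltnW.
have mx : measurable_fun (cube X T) (fun x : T.-tuple R => tnth x o).
  by apply: measurable_funTS; exact: measurable_tnth.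
have mpreG (G : t.-tuple R -> R) : measurable_fun (cube X t) G ->
    measurable_fun (cube X T) (fun x : T.-tuple R => G (tuple_of_seq t x)).
  move=> mG; apply: (measurable_comp (@mcX t)) mG _.
    by move=> _ [x cx <-]; exact: pre_cube.
  exact: measurable_funTS.
have wE (x : T.-tuple R) : wealth mu lam t.+1 x =
    low (tuple_of_seq t x) * (1 - tnth x o) + high (tuple_of_seq t x) * tnth x o.
  rewrite wealthS /low /high tuple_of_seqE ?size_tuple 1?ltnW// wealth_take//.
  by rewrite (tnth_nth 0) /=; ring.
under eq_integral do rewrite wE EFinD.
have coord := integral_coord HP (t := o).
rewrite (ge0_integralD P (@mcX T))//; last 4 first.
- move=> x cx; have /andP[_ x1] := cube01 o cx.
  by rewrite lee_fin mulr_ge0 ?subr_ge0 ?low0//; exact: pre_cube.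
- by apply/measurable_EFinP; apply: measurable_funM;
    [exact: mpreG|exact: measurable_funB].
- move=> x cx; have /andP[x0 _] := cube01 o cx.
  by rewrite lee_fin mulr_ge0 ?high0//; exact: pre_cube.
- by apply/measurable_EFinP; apply: measurable_funM; [exact: mpreG|].
rewrite (ge0_integral_weight mpre (@mcX T) (@mcX t) pre_cube (c := 1 - mu))//; last 4 first.
- exact: measurable_funB.
- by move=> x cx; have /andP[_ x1] := cube01 o cx; rewrite subr_ge0.
- by rewrite subr_ge0 ltW.
- by move=> B mB; have [_] := coord B mB.
rewrite (ge0_integral_weight mpre (@mcX T) (@mcX t) pre_cube (c := mu))//; last 3 first.
- by move=> x cx; have /andP[] := cube01 o cx.
- exact: ltW.
- by move=> B mB; have [] := coord B mB.
have nu0 : 0 <= 1 - mu by rewrite subr_ge0 ltW.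
have lowE0 x : cube X T x -> (0 <= (low (tuple_of_seq t x))%:E)%E.
  by move=> cx; rewrite lee_fin low0//; exact: pre_cube.
have highE0 x : cube X T x -> (0 <= (high (tuple_of_seq t x))%:E)%E.
  by move=> cx; rewrite lee_fin high0//; exact: pre_cube.
have mlowE : measurable_fun (cube X T) (fun x : T.-tuple R => (low (tuple_of_seq t x))%:E).
  by apply/measurable_EFinP; exact: mpreG.
have mhighE : measurable_fun (cube X T) (fun x : T.-tuple R => (high (tuple_of_seq t x))%:E).
  by apply/measurable_EFinP; exact: mpreG.
rewrite -(ge0_integralZl_EFin P (@mcX T) lowE0 mlowE nu0).
rewrite -(ge0_integralZl_EFin P (@mcX T) highE0 mhighE (ltW mu0)).
rewrite -(ge0_integralD P (@mcX T))//; last 4 first.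
- by move=> x cx; rewrite mule_ge0 ?lowE0.
- by apply: emeasurable_funM => //; exact: measurable_cst.
- by move=> x cx; rewrite mule_ge0 ?highE0// lee_fin ltW.
- by apply: emeasurable_funM => //; exact: measurable_cst.
apply: eq_integral => x _; rewrite -!EFinM -EFinD; congr EFin.
rewrite /low /high tuple_of_seqE ?size_tuple 1?ltnW// wealth_take//.
by ring.
Qed.

End expectation.

(** * Finitely supported martingales *)

Lemma finitely_supported_probability d (Y : measurableType d) (R : realType)
    (l : seq (R * Y)) : all (fun c => 0 <= c.1) l -> \sum_(c <- l) c.1 = 1 ->
  exists P : probability Y R, forall (D : set Y) (f : Y -> R), measurable D ->
    measurable_fun D f -> (forall x, D x -> 0 <= f x) ->
    (\int[P]_(x in D) (f x)%:E = (\sum_(c <- l | c.2 \in D) c.1 * f c.2)%:E)%E.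
Proof.
case: l => [|c0 l0]; first by rewrite big_nil => _ /esym/eqP; rewrite oner_eq0.
set l := c0 :: l0 => l_ge0 l1.
(* The absolute value supplies the sign that [mscale] requires; the weights are nonnegative. *)
pose m k : {measure set Y -> \bar R} :=
  mscale (NngNum (normr_ge0 (nth c0 l k).1)) (\d_(nth c0 l k).2).
pose M : {measure set Y -> \bar R} := msum m (size l).
have intM (D : set Y) (f : Y -> R) : measurable D -> measurable_fun D f ->
    (forall x, D x -> 0 <= f x) ->
    (\int[M]_(x in D) (f x)%:E = (\sum_(c <- l | c.2 \in D) c.1 * f c.2)%:E)%E.
  move=> mD mf f0.
  have mfE : measurable_fun D (EFin \o f) by exact/measurable_EFinP.
  rewrite /M ge0_integral_measure_sum//.
  rewrite (big_nth c0) big_mkord /= -sumEFin [RHS]big_mkcond /=; apply: eq_bigr => k _.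
  rewrite ge0_integral_mscale// integral_dirac// diracE /= ger0_norm; last first.
    exact: (all_nthP c0 l_ge0).
  by case: (_ \in D); rewrite ?mul1e ?mul0e ?mule0.
have M1 : M [set: Y] = 1%E.
  rewrite -[LHS]mul1e -(integral_cst M measurableT 1%E).
  rewrite (intM setT (cst 1)) //.
  under eq_bigl do rewrite in_setT.
  by under eq_bigr do rewrite mulr1; rewrite l1.
clearbody M.
(* The mass is already 1: normalising only supplies the structure of a probability. *)
exists (mnormalize M \d_(c0.2)) => D f mD mf f0; rewrite -intM//.
apply: eq_measure_integral => A _ _.
suff PM : mnormalize M \d_(c0.2) A = M A by exact: PM.
rewrite /mnormalize M1 onee_eq0 orFb (_ : (1 == +oo)%E = false)//.
by rewrite [fine _]/(1 : R) invr1 mule1.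
Qed.

Section plan.
Context (R : realType) (X : set R) (T : nat) (mu : R) (E : T.-tuple R -> R).
Hypotheses (mX : measurable X) (X01 : X `<=` `[0, 1]) (mu0 : 0 <= mu).

(* A finitely supported distribution on the continuations in [X^T] of [v.1], a
   martingale with mean [mu] from round [t] on, under which [E] has mean at
   least [v.2]. *)
Definition plan t (v : t.-tuple R * R) := exists l : seq (R * T.-tuple R),
  [/\ forall c, c \in l -> [/\ 0 <= c.1, cube X T c.2 & take t c.2 = v.1],
      \sum_(c <- l) c.1 = 1, v.2 <= \sum_(c <- l) c.1 * E c.2 &
      forall s, (t <= s < T)%N -> forall A : pred (seq R),
        \sum_(c <- l | A (take s c.2)) c.1 * (nth 0 c.2 s - mu) = 0].

(** The plans for the two outcomes are mixed with weights [w] and [1 - w]. After round [t] each is a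
    martingale by itself; at round [t] the past is constantly [x], and the condition is
    [w y + (1 - w) z = mu]. *)
Lemma plan_step t (H : set (t.+1.-tuple R * R)) : (t < T)%N ->
  H `<=` plan (t := t.+1) -> step X mu H `<=` plan (t := t).
Proof.
move=> tT Hplan [x q] [y [z [w [a [b [[Xy Xz /andP[w0 w1]] [wE Ha Hb /= ->]]]]]]].
have [l1 [l1P l1_1 l1E l1M]] := Hplan _ Ha.
have [l2 [l2P l2_1 l2E l2M]] := Hplan _ Hb.
pose scale r (c : R * T.-tuple R) := (r * c.1, c.2).
have nw0 : 0 <= 1 - w by rewrite subr_ge0.
have prefix_eq (u : R) (c : T.-tuple R) : take t.+1 c = rcons x u ->
    take t c = x /\ nth 0 c t = u.
  rewrite (take_nth 0) ?size_tuple// => /eqP; rewrite eqseq_rcons.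
  by move=> /andP[/eqP -> /eqP ->].
have sumE (F : R * T.-tuple R -> R) (A : pred (T.-tuple R)) :
    (forall r c, F (scale r c) = r * F c) ->
    \sum_(c <- map (scale w) l1 ++ map (scale (1 - w)) l2 | A c.2) F c =
    w * (\sum_(c <- l1 | A c.2) F c) + (1 - w) * (\sum_(c <- l2 | A c.2) F c).
  move=> FE; rewrite big_cat !big_map /= !big_distrr /=.
  by congr (_ + _); apply: eq_bigr => c _; rewrite FE.
exists (map (scale w) l1 ++ map (scale (1 - w)) l2); split.
- move=> c; rewrite mem_cat => /orP[] /mapP[c' /[dup] c'l].
    move=> /l1P[c0 cX /= /prefix_eq[cx _]] ->; split => //=; exact: mulr_ge0.
  move=> /l2P[c0 cX /= /prefix_eq[cx _]] ->; split => //=; exact: mulr_ge0.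
- rewrite (sumE (fun c => c.1) xpredT)// l1_1 l2_1; ring.
- rewrite (sumE (fun c => c.1 * E c.2) xpredT) => [|r c]; last by rewrite /= mulrA.
  by apply: lerD; exact: ler_wpM2l.
move=> s /andP[ts sT] A.
rewrite (sumE (fun c => c.1 * (nth 0 c.2 s - mu)) (fun c => A (take s c))); last first.
  by move=> r c; rewrite /= mulrA.
move: ts; rewrite leq_eqVlt => /orP[/eqP ts|ts]; last first.
  by rewrite l1M ?l2M ?ts// !mulr0 addr0.
rewrite -ts.
have sumA l u : (forall c, c \in l -> [/\ 0 <= c.1, cube X T c.2 &
      take t.+1 c.2 = rcons x u]) -> \sum_(c <- l) c.1 = 1 ->
    \sum_(c <- l | A (take t c.2)) c.1 * (nth 0 c.2 t - mu) =
    if A x then u - mu else 0.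
  move=> lP l_1; rewrite big_seq_cond.
  rewrite (eq_bigr (fun c => c.1 * (u - mu))); last first.
    by move=> c /andP[/lP[_ _ /prefix_eq[_ ->]]].
  rewrite (eq_bigl (fun c => (c \in l) && A x)); last first.
    move=> c; case cl : (c \in l) => //=.
    by have [_ _ /prefix_eq[-> _]] := lP c cl.
  case: (A x); last by rewrite big_pred0// => c; rewrite andbF.
  under eq_bigl do rewrite andbT.
  by rewrite -big_seq -big_distrl /= l_1 mul1r.
rewrite (sumA l1 y)// (sumA l2 z)//; case: (A x); last by rewrite !mulr0 addr0.
by rewrite -wE; ring.
Qed.

Lemma plan_bounded t (H : set (t.-tuple R * R)) : (t <= T)%N ->
  (forall v, plan (t := 0) v -> v.2 <= 1) ->
  H `<=` plan (t := t) -> bounded X mu H.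
Proof.
move=> tT plan1; elim: t H tT => [|t IH] H tT Hplan /=.
  by move=> v /Hplan/plan1.
by apply: IH; [exact: ltnW|exact: plan_step].
Qed.

(** At round 0 a plan is a martingale distribution on [X^T], hence a member of the hypothesis, under
    which [E] has mean at most 1. *)
Lemma evar_plan (v : 0.-tuple R * R) : evar X T mu E -> plan v -> v.2 <= 1.
Proof.
move=> [mE [E0 HE]] [l [lP l_1 lE lM]].
have [|//|P PE] := finitely_supported_probability (l := l).
  by apply/allP => c /lP[].
have mcX : measurable (cube X T) by exact: measurable_cube.
have l_cube c : c \in l -> c.2 \in cube X T by move=> /lP[_ cX _]; rewrite inE.
have sum_cube (F : R * T.-tuple R -> R) :
    \sum_(c <- l | c.2 \in cube X T) F c = \sum_(c <- l) F c.
  rewrite big_seq_cond [RHS]big_seq; apply: eq_bigl => c.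
  by case cl : (c \in l) => //=; rewrite l_cube.
have HP : Hmu X T mu P.
  have Pmass D : measurable D -> P D = (\sum_(c <- l | c.2 \in D) c.1)%:E.
    move=> mD; rewrite -[LHS]mul1e -(integral_cst P mD 1%E).
    rewrite (PE D (cst 1))//.
    by under eq_bigr do rewrite mulr1.
  split; first by rewrite Pmass// sum_cube l_1.
  move=> t B mB.
  rewrite (_ : Defs.prefix T t = fun x => tuple_of_seq t x); last first.
    by apply/funext => x; exact: prefixE.
  set D := _ `&` _.
  have mD : measurable D.
    apply: measurableI => //; rewrite -[X in measurable X]setTI.
    exact: measurable_tuple_of_seq.
  have ix := integrable_coord X01 P t mD (@subIsetl _ _ _).
  have imu : P.-integrable D (EFin \o cst mu) by exact: finite_measure_integrable_cst.
  rewrite (integralB_EFin (f1 := fun x => tnth x t) (f2 := cst mu) mD ix imu).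
  rewrite PE//; last 2 first.
  - by apply: measurable_funTS; exact: measurable_tnth.
  - by move=> x [/(_ t)/X01 + _]; rewrite /= in_itv => /andP[].
  rewrite (PE D (cst mu))// -EFinB; congr EFin.
  have := lM t; rewrite ltn_ord => /(_ isT).
  move=> /(_ (fun s => tuple_of_seq t s \in B)) /= e.
  rewrite -[RHS]e -sumrB.
  rewrite big_seq_cond [RHS]big_seq_cond; apply: eq_big => [c|c _].
    case cl : (c \in l) => //=; have [_ cX _] := lP c cl.
    have -> : tuple_of_seq t (take t c.2) = tuple_of_seq t c.2.
      by apply: eq_from_tnth => i; rewrite !tnth_mktuple nth_take.
    by apply/idP/idP; rewrite !inE; [case|move=> ?; split].
  by rewrite (tnth_nth 0) mulrBr.
have := HE P HP; rewrite PE// lee_fin sum_cube; exact: le_trans.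
Qed.

End plan.

(** * Optimality *)

Section optimality.
Context (R : realType) (X : set R) (T : nat) (mu : R).
Hypotheses (mX : measurable X) (X01 : X `<=` `[0, 1]) (X0 : X 0) (X1 : X 1).
Hypotheses (mu0 : 0 < mu) (mu1 : mu < 1).

Lemma Elam_wealth (lam : nat -> seq R -> R) (x : T.-tuple R) :
  Elam T mu (fun t y => lam t y) x = wealth mu lam T x.
Proof.
apply: eq_bigr => t _.
by rewrite prefixE tuple_of_seqE ?size_tuple 1?ltnW// (tnth_nth 0).
Qed.

Lemma Lambda_nat (lam : forall t : 'I_T, t.-tuple R -> R) :
  Lambda X T mu lam -> exists lam' : nat -> seq R -> R,
    [/\ forall s, (s < T)%N -> measurable_fun (cube X s) (fun y : s.-tuple R => lam' s y),
        forall s (y : s.-tuple R), (s < T)%N -> cube X s y -> Imu mu (lam' s y) &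
        Elam T mu lam = Elam T mu (fun t y => lam' t y)].
Proof.
move=> lamP.
(* The bet defaults to 0 beyond the horizon. *)
pose lam' s l := if insub s is Some t then lam t (tuple_of_seq t l) else 0.
have lamE s (sT : (s < T)%N) (y : s.-tuple R) : lam' s y = lam (Ordinal sT) y.
  by rewrite /lam' insubT /= tuple_of_seqK.
exists lam'; split.
- move=> s sT; have [ml _] := lamP (Ordinal sT).
  by under eq_fun do rewrite lamE.
- by move=> s y sT cy; rewrite lamE; have [_] := lamP (Ordinal sT); apply.
apply/funext => x; apply: eq_bigr => -[t tT] _.
by rewrite lamE.
Qed.

Lemma Ecb_evar : eclass X T mu (Ecb X T mu).
Proof.
move=> _ [_ /Lambda_nat[lam [mlam lamI ->]] ->].
have ->: Elam T mu (fun t y => lam t y) = fun x => wealth mu lam T x.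
  by apply/funext => x; exact: Elam_wealth.
split; first exact: measurable_wealth.
split=> [x cx|P HP]; first exact: (wealth_ge0 X01 mu0 mu1 lamI).
by rewrite (integral_wealth mX X01 mu0 mu1 HP mlam lamI).
Qed.

Lemma Ecb_majorising : majorising X T mu (Ecb X T mu).
Proof.
split; first exact: Ecb_evar.
move=> E evE; have [mE [E0 _]] := evE.
(* The hypograph of [E]: all levels below [E] are included, so that 0 is a constraint everywhere. *)
pose H : set (T.-tuple R * R) := [set v | cube X T v.1 /\ v.2 <= E v.1].
have aH : analytic H.
  apply: measurable_analytic.
    apply: analyticT_prod; last exact: analyticT_real.
    - exact/separated_tuple/separated_real.
    - exact: separated_real.
    - exact: analyticT_tuple.
  have mcX : measurable (cube X T) by exact: measurable_cube.
  pose D := (fun v : T.-tuple R * R => v.1) @^-1` cube X T.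
  have mD : measurable D.
    by rewrite -[X in measurable X]setTI; apply: measurable_fst.
  have -> : H = D `&` (fun v => E v.1 - v.2) @^-1` `[0, +oo[.
    by apply/seteqP; split=> v; rewrite /= in_itv /= andbT subr_ge0.
  have mEv : measurable_fun D (fun v => E v.1 - v.2).
    apply: measurable_funB; last by apply: measurable_funTS; exact: measurable_snd.
    apply: (measurable_comp mcX) mE _; first by move=> _ [v cv <-].
    by apply: measurable_funTS; exact: measurable_fst.
  exact: mEv.
have H0 x : cube X T x -> H (x, 0) by move=> cx; split => //=; exact: E0.
have bH : bounded X mu H.
  apply: (plan_bounded (E := E) (leqnn T)).
    by move=> v /(evar_plan mX X01 (ltW mu0)); apply.
  (* At the horizon the plan is the point mass at [x], with no round left for the martingale
     condition. *)
  move=> [x a] [/= cx aE]; exists [:: (1, x)]; split.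
  - move=> c; rewrite inE => /eqP ->; split => //=.
    by rewrite take_oversize// size_tuple.
  - exact: big_seq1.
  - by rewrite big_seq1 /= mul1r.
  - by move=> s; rewrite ltnNge andbN.
have [lam [mlam lamI le_lam]] := wealth_majorises mX X0 X1 mu0 mu1 aH H0 bH.
exists (Elam T mu (fun t y => lam t y)).
  exists (fun t y => lam t y) => // t; split; last by move=> y _; exact: lamI.
  by apply: measurable_funTS; exact: mlam.
by move=> x cx; rewrite Elam_wealth; apply: le_lam.
Qed.

Lemma Elam_maximal E E' : Ecb X T mu E -> Ecb X T mu E' ->
  (forall x, cube X T x -> E x <= E' x) -> forall x, cube X T x -> E x = E' x.
Proof.
move=> [_ /Lambda_nat[lam [_ _ ->]] ->] [_ /Lambda_nat[lam' [_ _ ->]] ->] le_E x cx.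
rewrite !Elam_wealth; apply: (wealth_maximal (X := X)) => //; first by rewrite mu0.
by move=> y cy; rewrite -!Elam_wealth; exact: le_E.
Qed.

End optimality.
Unset Implicit Arguments.

Theorem theorem2 (R : realType) (X : set R) (T : nat) (mu : R)
  (mX : measurable X) (X01 : X `<=` `[0, 1]) (X0 : X 0) (X1 : X 1)
  (T1 : (0 < T)%N) (mu0 : 0 < mu) (mu1 : mu < 1) :
  optimal X T mu (Ecb X T mu).
Proof.
split; first exact: Ecb_majorising.
move=> C [Cevar Cmaj] E cbE.
(* [E <= E1 <= E2] with [E1] in [C] and [E2] again in [Ecb]; maximality gives [E = E2], which
   squeezes [E1]. *)
have [E1 CE1 EE1] := Cmaj E (Ecb_evar mX X01 mu0 mu1 cbE).
exists E1 => // x cx.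
have [_ /(_ E1 (Cevar _ CE1)) [E2 cbE2 E12]] :=
  @Ecb_majorising R X T mu mX X01 X0 X1 mu0 mu1.
have EE2 : E x = E2 x.
  apply: (Elam_maximal X0 X1 mu0 mu1 cbE cbE2) => // y cy.
  exact: le_trans (EE1 y cy) (E12 y cy).
by apply/eqP; rewrite eq_le EE1//= EE2 E12.
Qed.
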